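(* There exist $d^*>0$ and, for each $d>0$, a constant $\mathcal{C}(d)$ depending only on $d$, with $$0<\mathcal{C}(d)<1\qquad\text{for } d\in(0,d^* ),$$ such that the following holds. Let $d>0$, let $I=[0,1]$, let $(\rho_0,J_0)\in L^\infty(I)$ with $\int_I\rho_0\,dx=0$, and let $(\rho,J)$ be the weak solution of $$\partial_t\rho+\partial_xJ=0,\qquad \partial_tJ+\partial_x\rho=-2dJ,\qquad x\in I,\ t\ge0,$$ $$(\rho,J)(\cdot,0)=(\rho_0,J_0),\qquad J(0,t)=J(1,t)=0 .$$ With $f^\pm=\frac{\rho\pm J}{2}$ and $f_0^\pm=\frac{\rho_0\pm J_0}{2}$, one has, for all $t\ge 1$, $$\operatorname{ess\,sup}_I f^\pm(\cdot,t)-\operatorname{ess\,inf}_I f^\pm(\cdot,t)\le\mathcal{C}(d)\left(\operatorname{ess\,sup}_I f_0^\pm-\operatorname{ess\,inf}_I f_0^\pm\right).$$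
   Context: Convention: $\operatorname{ess\,sup}_I f^\pm$ denotes $\max\{\operatorname{ess\,sup}_I f^+,\operatorname{ess\,sup}_I f^-\}$ and $\operatorname{ess\,inf}_I f^\pm$ denotes $\min\{\operatorname{ess\,inf}_I f^+,\operatorname{ess\,inf}_I f^-\}$ (joint over both signs); likewise for $f_0^\pm$. Weak solution of the problem: a function $(\rho,J):I\times[0,+\infty)\to\mathbb{R}^2$ such that (a) $t\mapsto(\rho,J)(\cdot,t)\in L^\infty(I)\subset L^1(I)$ is continuous on $[0,\infty)$ with respect to the $L^1(I)$ norm and equals $(\rho_0,J_0)$ at $t=0$; (b) $\int_0^\infty\int_0^1\{\rho\,\partial_t\phi+J\,\partial_x\phi\}\,dx\,dt=0$ for all $\phi\in C^1([0,1]\times(0,\infty))$ with compact support in $[0,1]\times(0,\infty)$ (this encodes the boundary condition), and $\int_0^\infty\int_0^1\{J\,\partial_t\phi+\rho\,\partial_x\phi-2dJ\phi\}\,dx\,dt=0$ for all $\phi\in C^1$ with compact support in $(0,1)\times(0,\infty)$. For $(\rho_0,J_0)\in L^\infty(I)$ with $\int_I\rho_0=0$ such a weak solution exists and is unique. *)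

(* Defs.v *)
From HB Require Import structures.
From mathcomp Require Import all_boot all_order all_algebra.
From mathcomp Require Import all_classical all_reals all_analysis.
From mathcomp Require Import ess_sup_inf.

Set Implicit Arguments.
Unset Strict Implicit.
Unset Printing Implicit Defensive.

Import Order.TTheory GRing.Theory Num.Theory.
Import numFieldNormedType.Exports.

Local Open Scope classical_set_scope.
Local Open Scope ring_scope.

(* Functions on I = [0, 1] are represented by functions on R whose values
   outside I are never used; likewise functions on a subset of the (x, t) plane
   are functions on R * R.  An element of L^oo(I) is given by a representative,
   and equality in L^oo(I) is almost-everywhere equality on I. *)

Definition I01 (R : realType) : set R := `[0, 1].
Arguments I01 R : clear implicits.

Definition lebI (R : realType) : {measure set (measurableTypeR R) -> \bar R} :=
  [the {measure set (measurableTypeR R) -> \bar R} of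
    mrestr (@lebesgue_measure R) (measurable_itv `[0 : R, 1 : R])].

Definition in_Linfty_I (R : realType) (f : R -> R) : Prop :=
  measurable_fun (I01 R) f /\ ('N[lebI R]_+oo[EFin \o f] < +oo)%E.

Definition L1dist_I (R : realType) (f g : R -> R) : \bar R :=
  (\int[lebesgue_measure]_(x in I01 R) `|f x - g x|%:E)%E.

(* For a function of (x, t), [u t] below is the time slice u(., t). *)
Definition continuous_to_L1_I (R : realType) (u : R -> R -> R) : Prop :=
  forall s : R, 0 <= s ->
    L1dist_I (u t) (u s) @[t --> within `[0, +oo[ (nbhs s)] --> 0%E.

(* C^1 regularity on a set Q that need not be open: phi and its two partial
   derivatives, which exist in the interior of Q, extend continuously to Q. *)
Definition C1_on (R : realType) (Q : set (R * R)) (phi phi_x phi_t : R * R -> R)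
    : Prop :=
  [/\ {within Q, continuous phi},
      {within Q, continuous phi_x},
      {within Q, continuous phi_t} &
      forall p, interior Q p ->
        is_derive p (1, 0) phi (phi_x p) /\ is_derive p (0, 1) phi (phi_t p)].

Definition compactly_supported_in (R : realType) (Q : set (R * R))
    (phi : R * R -> R) : Prop :=
  let supp := closure (Q `&` [set p | phi p != 0]) in
  compact supp /\ supp `<=` Q.

Definition test_function (R : realType) (Q : set (R * R))
    (phi phi_x phi_t : R * R -> R) : Prop :=
  C1_on Q phi phi_x phi_t /\ compactly_supported_in Q phi.

(* The integrals are iterated, as t |-> (rho, J)(., t) being continuous into
   L^1(I) does not make the chosen representatives jointly measurable.
   In the second identity phi is only meaningful for 0 < x < 1; the endpoints
   do not affect the inner integral. *)
Record weak_solution (R : realType) (d : R) (rho0 J0 : R -> R)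
    (rho J : R -> R -> R) : Prop := WeakSolution {
  weak_Linfty : forall t : R, 0 <= t ->
    in_Linfty_I (rho ^~ t) /\ in_Linfty_I (J ^~ t) ;
  weak_continuous :
    continuous_to_L1_I (fun t => rho ^~ t) /\ continuous_to_L1_I (fun t => J ^~ t) ;
  weak_initial :
    ae_eq lebesgue_measure (I01 R) (rho ^~ 0) rho0 /\
    ae_eq lebesgue_measure (I01 R) (J ^~ 0) J0 ;
  (* the test functions need not vanish at x = 0, 1: this encodes
     J(0, t) = J(1, t) = 0 *)
  weak_mass : forall phi phi_x phi_t : R * R -> R,
    test_function (`[0, 1] `*` `]0, +oo[) phi phi_x phi_t ->
    \int[lebesgue_measure]_(t in `]0, +oo[)
      \int[lebesgue_measure]_(x in I01 R)
        (rho x t * phi_t (x, t) + J x t * phi_x (x, t)) = 0 ;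
  weak_momentum : forall phi phi_x phi_t : R * R -> R,
    test_function (`]0, 1[ `*` `]0, +oo[) phi phi_x phi_t ->
    \int[lebesgue_measure]_(t in `]0, +oo[)
      \int[lebesgue_measure]_(x in I01 R)
        (J x t * phi_t (x, t) + rho x t * phi_x (x, t)
         - 2 * d * J x t * phi (x, t)) = 0
}.

Definition ess_sup_pm (R : realType) (fp fm : R -> R) : \bar R :=
  maxe (ess_sup (lebI R) (EFin \o fp)) (ess_sup (lebI R) (EFin \o fm)).

Definition ess_inf_pm (R : realType) (fp fm : R -> R) : \bar R :=
  mine (ess_inf (lebI R) (EFin \o fp)) (ess_inf (lebI R) (EFin \o fm)).

(* Main.v *)
(* Extend f^+ to the circle R / 2Z by reflecting f^- onto (-1, 0).  The system
   becomes g_t + g_y = - d (g(y) - g(- y)), so along the characteristics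
   h(y, t) = g(y + t, t) solves h_t(y) = d (h(- y - 2 t) - h(y)).  Everything is
   done by duality: testing the weak formulation with waves theta(x - t) and
   theta(- x - t), for a 2-periodic C^1 function theta, gives for
   W theta t = int h(., t) theta
   the equation (W theta)'(t) = d (W (R_t theta) t - W theta t), where
   R_t theta(y) = theta(- y - 2 t).  Iterating Duhamel's formula gives the
   maximum principle.  On 0 <= t <= 1 the function h stays O(d)-close to its
   initial value, and the average of R_t theta over 0 <= t <= 1 is constant, so
   that int rho_0 = 0 kills the gain term up to O(d^2):
   W theta 1 <= (1 - d) W theta 0 + O(d^2).
   Hence C(d) = 1 - d + 4 d^2, which is less than 1 for d < 1/4; for d >= 1/4 it
   is at least 1 and the maximum principle suffices. *)
Require Import Defs.
From HB Require Import structures.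
From mathcomp Require Import all_boot all_order all_algebra.
From mathcomp Require Import all_classical all_reals all_analysis.
From mathcomp Require Import measurable_realfun ess_sup_inf ring lra.

Set Implicit Arguments.
Unset Strict Implicit.
Unset Printing Implicit Defensive.
Import Order.TTheory GRing.Theory Num.Theory.
Import numFieldNormedType.Exports.

Local Open Scope classical_set_scope.
Local Open Scope ring_scope.

(** * Calculus and integration on the line *)

(** A time slice is known only up to null sets and the slices fit together only through continuity
    into [L^1(I)], so the solution cannot be followed along individual characteristics. The scalar
    functions [W theta], in contrast, are continuous in time. A bound [W theta t <= M * mass theta]
    for all [theta] with values in [[0, 1]] amounts to the almost-everywhere bound [M] on both [f^+]
    and [f^-], and it propagates because [R_t] preserves [mass]. The obstacle is the boundary:
    momentum tests must vanish near [x = 0] and [x = 1], and waves do not. But the weight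
    [theta (x - t) - theta (- x - t)] of [J] is zero at [x = 0] by symmetry and at [x = 1] by
    periodicity, hence [O(x * (1 - x))], which compensates the derivative of a cutoff. Origin of
    [4 * d ^+ 2]: let [K] be the initial oscillation. Mean zero places [0] between the initial
    bounds, so [K] bounds the solution and [W theta] moves by at most [2 * d * K * t * mass theta].
    Gain and loss both carry this error; integrating [4 * d ^+ 2 * K * t] over [[0, 1]] gives
    [2 * d ^+ 2 * K], once for the upper and once for the lower bound. *)

Section real_analysis.
Variable R : realType.
Implicit Types f g F : R -> R.
Local Notation mu := (@lebesgue_measure R).

Lemma is_derive_continuous f (f' : R -> R) :
  (forall x : R, is_derive x 1 f (f' x)) -> continuous f.
Proof.
move=> df x; apply/differentiable_continuous; apply/derivable1_diffP.
by have [] := df x.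
Qed.

Lemma continuous_integrable_itv f (a b : R) : continuous f ->
  mu.-integrable `[a, b] (EFin \o f).
Proof.
move=> cf; apply: continuous_compact_integrable; first exact: segment_compact.
exact: continuous_subspaceT.
Qed.

Lemma is_derive_of_derive1 f (x d : R) :
  derivable f x 1 /\ f^`()%classic x = d -> is_derive x 1 f d.
Proof. by move=> [df <-]; rewrite derive1E; exact/derivableP. Qed.

Lemma Rintegral_derive F f (a b : R) : a <= b -> continuous f ->
  (forall x : R, is_derive x 1 F (f x)) ->
  \int[mu]_(x in `[a, b]) f x = F b - F a.
Proof.
rewrite le_eqVlt => /predU1P[<- _ _|ab cf dF].
  by rewrite set_itv1 Rintegral_set1 subrr.
rewrite /Rintegral (@continuous_FTC2 _ f F)//.
- exact: continuous_subspaceT.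
- have cF := is_derive_continuous dF; split.
  + by move=> x _; have [] := dF x.
  + by apply: cvg_at_right_filter; exact: cF.
  + by apply: cvg_at_left_filter; exact: cF.
- by move=> x _; rewrite derive1E; have [_ ->] := dF x.
Qed.

Lemma antiderivative f : continuous f ->
  exists F, forall x : R, is_derive x 1 F (f x).
Proof.
move=> cf; pose J a y := \int[mu]_(x in `[a, y]) f x.
have J_shift a b y : a <= b -> b <= y -> J a y = J a b + J b y.
  move=> ab b_y; rewrite /J.
  have := @Rintegral_itvB R f (BLeft a) (BRight y) b.
  rewrite !bnd_simp => /(_ (continuous_integrable_itv _ _ cf) ab b_y).
  rewrite Rintegral_itv_obnd_cbnd; last first.
    apply: integrableS (continuous_integrable_itv b y cf) => //.
    exact: subset_itv_oc_cc.
  by move=> <-; rewrite addrC subrK.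
(* The base point moves with [y] so as to stay to the left of both [y] and [0]. By additivity the
   difference does not depend on it, and near [x] it can be replaced by the fixed [c]. *)
exists (fun y => J (- `|y| - 1) y - J (- `|y| - 1) 0) => x.
pose c : R := - `|x| - 2.
have cx : c < x.
  by rewrite /c; have := ler_norm (- x); rewrite normrN; lra.
apply/is_derive_of_derive1.
have Je : \forall y \near x, J c y - J c 0 =
    J (- `|y| - 1) y - J (- `|y| - 1) 0.
  near=> y.
  have xy : `|x - y| < 1 by near: y; apply: cvgr_dist_lt; [exact: cvg_id|].
  have cy : c <= - `|y| - 1.
    rewrite /c; have := ler_normD (y - x) x.
    rewrite subrK distrC in xy *; lra.
  rewrite (J_shift c _ y cy); last first.
    have := ler_norm (- y); rewrite normrN; lra.
  rewrite (J_shift c _ 0 cy); last by have := normr_ge0 y; lra.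
  by rewrite opprD addrACA subrr add0r.
have [|] := @continuous_FTC1_closed R f c x (x + 1) _
  (continuous_integrable_itv _ _ cf) cx (cf x); first by rewrite ltrDl.
move=> dJ J'.
have dJ0 : is_derive x 1 (fun y => J c y - J c 0) (f x).
  rewrite -[f x]subr0 ; apply: is_deriveB.
  by apply/is_derive_of_derive1.
split.
  by apply: near_eq_derivable Je _; rewrite ?oner_neq0//; have [] := dJ0.
rewrite derive1E -(near_eq_derive _ Je) ?oner_neq0//.
by have [] := dJ0.
Unshelve. all: by end_near. Qed.

(** The derivative is asked for only to the right of [a]: the evolution equation holds at positive
    times, while [a] is often the initial time. *)
Lemma derive_le0_le g (g' : R -> R) (a b : R) :
  continuous g -> (forall t : R, a < t -> is_derive t 1 g (g' t)) ->
  (forall t, a < t -> t < b -> g' t <= 0) -> a <= b -> g b <= g a.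
Proof.
move=> cg dg g'0; rewrite le_eqVlt => /predU1P[->//|ab].
have [||c] := @MVT R g g' a b ab.
- by move=> x; rewrite in_itv/= => /andP[ax _]; exact: dg.
- exact: continuous_subspaceT.
rewrite in_itv/= => /andP[ac cb] gab.
by rewrite -subr_le0 gab mulr_le0_ge0 ?g'0// subr_ge0 ltW.
Qed.

Lemma derive_eq0_cst g : (forall t : R, is_derive t 1 g 0) -> forall a b, g a = g b.
Proof.
move=> dg a b; wlog ab : a b / a <= b.
  by move=> w; have [|/ltW] := leP a b => /w.
have cg := is_derive_continuous dg.
apply/le_anti/andP; split.
  rewrite -lerN2; apply: (@derive_le0_le (fun t => - g t) (fun=> - 0)) => //.
    by move=> t; apply: cvgN; exact: cg.
exact: (@derive_le0_le g (fun=> 0)).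
Qed.

(** Squaring removes the kink at [0], which makes [pospart _ ^+ 2] the C^1 ingredient of the bumps
    and cutoffs. Composing with [pospart] also freezes a function of time before time [0]. *)
Definition pospart (z : R) : R := (z + `|z|) / 2.

Lemma pospart_id z : 0 <= z -> pospart z = z.
Proof. by move=> z0; rewrite /pospart ger0_norm//; field. Qed.

Lemma pospart_eq0 z : z <= 0 -> pospart z = 0.
Proof. by move=> z0; rewrite /pospart ler0_norm// subrr mul0r. Qed.

Lemma pospart_ge0 z : 0 <= pospart z.
Proof. by rewrite /pospart divr_ge0// -lerBlDl sub0r -normrN ler_norm. Qed.

Lemma continuous_pospart : continuous pospart.
Proof.
move=> z; apply: cvgMl; apply: cvgD; first exact: cvg_id.
by apply: cvg_norm; exact: cvg_id.
Qed.

Lemma is_derive_sqr_pospart (z : R) :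
  is_derive z 1 (fun y => pospart y ^+ 2) (2 * pospart z).
Proof.
have [z0|z0|->] := ltgtP z 0.
- rewrite pospart_eq0 ?ltW// mulr0.
  apply: (@near_eq_is_derive _ _ _ (fun=> 0)) => //.
  near=> y; have y0 : y < 0 by near: y; exact: lt_nbhsl.
  by rewrite pospart_eq0 ?expr0n// ltW.
- rewrite pospart_id ?ltW//.
  apply: (@near_eq_is_derive _ _ _ (fun y : R => y * y)).
    by near=> y; have y0 : 0 < y by [near: y; exact: lt_nbhsr]; rewrite pospart_id ?expr2// ltW.
  apply: (is_derive_eq (is_deriveM (is_derive_id z 1) (is_derive_id z 1))).
  by rewrite /GRing.scale/=; ring.
(* At the kink, [pospart y ^+ 2 = pospart y * y], so the slope function is [pospart] itself. *)
- apply/is_derive1_caratheodory; exists pospart; split.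
  + move=> y; rewrite [pospart 0]pospart_eq0// expr0n/= !subr0.
    have [y0|/ltW y0] := leP 0 y; first by rewrite pospart_id// expr2.
    by rewrite pospart_eq0// expr0n mul0r.
  + exact: continuous_pospart.
  + by rewrite pospart_eq0// mulr0.
Unshelve. all: by end_near. Qed.

Lemma Rintegral_dominated_cvg d (T : measurableType d)
    (nu : {measure set T -> \bar R}) (D : set T) (f_ : nat -> T -> R)
    (f G : T -> R) :
  measurable D -> (forall n, measurable_fun D (f_ n)) ->
  (forall x, D x -> f_ n x @[n --> \oo] --> f x) ->
  nu.-integrable D (EFin \o G) ->
  (forall n x, D x -> `|f_ n x| <= G x) ->
  \int[nu]_(x in D) f_ n x @[n --> \oo] --> \int[nu]_(x in D) f x.
Proof.
move=> mD mf cf iG leG.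
have mf_ n : measurable_fun D (EFin \o f_ n) by exact/measurable_EFinP.
have cf_ x : D x -> (f_ n x)%:E @[n --> \oo] --> (f x)%:E.
  by move=> Dx; apply: cvg_EFin; [exact: nearW|exact: cf].
have [] := @dominated_convergence _ T R nu D mD (fun n x => (f_ n x)%:E)
  (EFin \o f) (EFin \o G).
- exact: mf_.
- exact: emeasurable_fun_cvg mf_ cf_.
- by apply: aeW => x Dx; exact: cf_.
- exact: iG.
- by apply: aeW => x n Dx; rewrite lee_fin leG.
move=> if_ _ h.
apply: fine_cvg => /=; rewrite fineK; first exact: h.
exact: integrable_fin_num.
Qed.

End real_analysis.

(** * The du Bois-Reymond lemma: a continuous weak derivative is a derivative *)

Section du_bois_reymond.
Variable R : realType.
Implicit Types f g F : R -> R.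
Local Notation mu := (@lebesgue_measure R).

(** An antiderivative of [f] is nondecreasing with equal values at [a] and [b], so it is constant in
    between and its derivative vanishes. *)
Lemma Rintegral_eq0_continuous f (a b : R) : a < b -> continuous f ->
  (forall x, 0 <= f x) -> \int[mu]_(x in `[a, b]) f x = 0 ->
  forall x, a < x < b -> f x = 0.
Proof.
move=> ab cf f0 intf0 x /andP[ax xb].
have [F dF] := antiderivative cf.
have ndF y z : y <= z -> F y <= F z.
  move=> yz; rewrite -subr_ge0 -(Rintegral_derive yz cf dF).
  exact: Rintegral_ge0.
have Fab : F b = F a.
  by apply/eqP; rewrite -subr_eq0 -(Rintegral_derive (ltW ab) cf dF) intf0.
have Fcst : \forall y \near x, F y = F a.
  have : x \in `]a, b[ by rewrite in_itv/= ax.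
  move=> /near_in_itvoo; apply: filterS => y; rewrite in_itv/= => /andP[ay yb].
  by apply/le_anti; rewrite -{1}Fab !ndF// ltW.
have [_ <-] := dF x.
rewrite (near_eq_derive _ Fcst) ?oner_neq0//.
exact: derive_cst.
Qed.

(** The difference [D] of [F] and an antiderivative of [f] is orthogonal to every [chi']. Choosing
    [chi' = (D - c) * w], with [c] the [w]-weighted mean of [D], shows that [(D - c) ^+ 2 * w] has
    integral zero, so [D] is constant near [t]. *)
Lemma du_bois_reymond f (F : R -> R) :
  continuous F -> continuous f ->
  (forall (a b : R) (chi chi' : R -> R), 0 < a -> a < b -> continuous chi' ->
    (forall t : R, is_derive t 1 chi (chi' t)) ->
    (forall t : R, t <= a \/ b <= t -> chi t = 0 /\ chi' t = 0) ->
    \int[mu]_(t in `[a, b]) (chi' t * F t + chi t * f t) = 0) ->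
  forall t : R, 0 < t -> is_derive t 1 F (f t).
Proof.
move=> cF cf h t t0.
have [G dG] := antiderivative cf.
have cG := is_derive_continuous dG.
pose D x := F x - G x.
have cD : continuous D by move=> x; apply: cvgB; [exact: cF|exact: cG].
pose a := t / 2; pose b := t + 1.
have a0 : 0 < a by rewrite divr_gt0.
have at_ : a < t by rewrite /a; lra.
have tb : t < b by rewrite ltrDl.
have ab : a < b := lt_trans at_ tb.
(* Continuous, positive on []a, b[] and zero elsewhere: multiplying by [w] localizes [D - c] and
   keeps [chi'] continuous. *)
pose w x := pospart ((x - a) * (b - x)).
have wE x : a < x < b -> w x = (x - a) * (b - x).
  by move=> /andP[ax xb]; rewrite /w pospart_id// mulr_ge0// subr_ge0 ltW.
have w0 x : x <= a \/ b <= x -> w x = 0.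
  by move=> abx; rewrite /w pospart_eq0//; nra.
have w_ge0 x : 0 <= w x by exact: pospart_ge0.
have cw : continuous w.
  have cq : continuous (fun x => (x - a) * (b - x)).
    move=> x; apply: cvgM; apply: cvgB; try exact: cvg_cst; exact: cvg_id.
  move=> x; apply: (@continuous_comp _ _ _ (fun x => (x - a) * (b - x)) (@pospart R)).
    exact: cq.
  exact: continuous_pospart.
have iw := continuous_integrable_itv a b cw.
have cDw : continuous (fun x => D x * w x).
  by move=> x; apply: cvgM; [exact: cD|exact: cw].
pose W := \int[mu]_(x in `[a, b]) w x.
have W0 : W != 0.
  apply/eqP => /(Rintegral_eq0_continuous ab cw w_ge0)/(_ t).
  rewrite wE at_ tb// => /(_ isT)/eqP; rewrite mulf_eq0 !subr_eq0.
  by rewrite (gt_eqF at_) (gt_eqF tb).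
pose c := (\int[mu]_(x in `[a, b]) (D x * w x)) / W.
pose chi' x := (D x - c) * w x.
have cchi' : continuous chi'.
  by move=> x; apply: cvgM; [apply: cvgB; [exact: cD|exact: cvg_cst]|exact: cw].
have ichi' := continuous_integrable_itv a b cchi'.
have [H dH] := antiderivative cchi'.
pose chi x := H x - H a.
have dchi (x : R) : is_derive x 1 chi (chi' x).
  by rewrite -[chi' x]subr0; exact: is_deriveB.
have cchi := is_derive_continuous dchi.
(* This is the purpose of [c]: since [chi'] has integral zero, [chi] is back at [0] from [b] on. *)
have intchi' : \int[mu]_(x in `[a, b]) chi' x = 0.
  rewrite /chi'; under eq_Rintegral do rewrite mulrBl.
  rewrite RintegralB//; last 2 first.
    exact: continuous_integrable_itv.
    by apply: continuous_integrable_itv => x; apply: cvgMr; exact: cw.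
  by rewrite RintegralZl// -/W /c divfK// subrr.
have Hab : H b = H a.
  by apply/eqP; rewrite -subr_eq0 -(Rintegral_derive (ltW ab) cchi' dH) intchi'.
have Hcst x y : (forall z, x < z < y -> z <= a \/ b <= z) -> x <= y -> H y = H x.
  move=> out; rewrite le_eqVlt => /predU1P[->//|xy].
  have [|z] := @MVT _ H chi' x y xy.
  - exact/continuous_subspaceT/(is_derive_continuous dH).
  - rewrite in_itv/= => /out /w0 wz /eqP.
    by rewrite /chi' wz mulr0 mul0r subr_eq0 => /eqP.
have chi0 x : x <= a \/ b <= x -> chi x = 0 /\ chi' x = 0.
  move=> abx; rewrite /chi' w0// mulr0; split => //; apply/eqP; rewrite subr_eq0.
  case: abx => [xa|bx].
    rewrite (Hcst x a)// => z /andP[_ /ltW za]; by left.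
  rewrite -Hab (Hcst b x)// => z /andP[/ltW bz _]; by right.
have intD : \int[mu]_(x in `[a, b]) (chi' x * D x) = 0.
  have := h a b chi chi' a0 ab cchi' dchi chi0.
  have -> : \int[mu]_(x in `[a, b]) (chi' x * F x + chi x * f x) =
      \int[mu]_(x in `[a, b]) (chi' x * D x) +
      \int[mu]_(x in `[a, b]) (chi' x * G x + chi x * f x).
    rewrite -RintegralD//.
    - by apply: eq_Rintegral => x _; rewrite /D; ring.
    - apply: continuous_integrable_itv => x.
      by apply: cvgM; [exact: cchi'|exact: cD].
    - apply: continuous_integrable_itv => x.
      by apply: cvgD; apply: cvgM;
        [exact: cchi'|exact: cG|exact: cchi|exact: cf].
  have dchiG (x : R) :
      is_derive x 1 (fun x => chi x * G x) (chi' x * G x + chi x * f x).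
    apply: (is_derive_eq (is_deriveM (dchi x) (dG x))).
    by rewrite /GRing.scale/=; ring.
  rewrite (Rintegral_derive (ltW ab) _ dchiG); last first.
    by move=> x; apply: cvgD; apply: cvgM;
      [exact: cchi'|exact: cG|exact: cchi|exact: cf].
  rewrite (chi0 b _).1; last by right.
  rewrite (chi0 a _).1; last by left.
  by rewrite !mul0r subrr addr0.
have Dc x : a < x < b -> D x = c.
  move=> abx.
  have cDchi : continuous (fun x => (D x - c) * chi' x).
    have cDc : continuous (fun x => D x - c).
      by move=> y; apply: cvgB; [exact: cD|exact: cvg_cst].
    by move=> y; exact: (cvgM (cDc y) (cchi' y)).
  have : (D x - c) * chi' x = 0.
    apply: (@Rintegral_eq0_continuous (fun x => (D x - c) * chi' x) a b ab) => //.
    - by move=> y; rewrite /chi' mulrA mulr_ge0// -expr2 sqr_ge0.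
    - transitivity (\int[mu]_(y in `[a, b]) (chi' y * D y - c * chi' y)).
        by apply: eq_Rintegral => y _; ring.
      rewrite RintegralB//; last 2 first.
        by apply: continuous_integrable_itv => y; apply: cvgM; [exact: cchi'|exact: cD].
        by apply: continuous_integrable_itv => y; apply: cvgMr; exact: cchi'.
      by rewrite RintegralZl// intchi' intD mulr0 subrr.
  move/eqP; rewrite mulrA -expr2 mulf_eq0 expf_eq0/= subr_eq0 => /orP[/eqP//|].
  rewrite wE//; case/andP: abx => ax xb.
  by rewrite mulf_eq0 !subr_eq0 (gt_eqF ax) (gt_eqF xb).
have FG : \forall x \near t, G x + c = F x.
  have : t \in `]a, b[ by rewrite in_itv/= at_.
  move=> /near_in_itvoo; apply: filterS => y; rewrite in_itv/= => /Dc <-.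
  by rewrite /D addrC subrK.
apply: (near_eq_is_derive FG).
by rewrite -[f t]addr0; exact: is_deriveD.
Qed.

End du_bois_reymond.

(** * Pairing an L^1-continuous curve with a continuous weight *)

Section pairing.
Variable R : realType.
Local Notation mu := (@lebesgue_measure R).

Lemma continuous_pair (T U V : topologicalType) (f : T -> U) (g : T -> V) :
  continuous f -> continuous g -> continuous (fun x => (f x, g x)).
Proof.
move=> cf cg x.
have := @cvg_pair T U V (nbhs x) (nbhs (f x)) (nbhs (g x)) _ _ _ f g.
by apply; [exact: cf|exact: cg].
Qed.

Lemma measurable_I01 : measurable (I01 R : set (measurableTypeR R)).
Proof. exact: measurable_itv. Qed.

Lemma integrable_measurable_fun (D : set (measurableTypeR R)) (u : R -> R) :
  mu.-integrable D (EFin \o u) -> measurable_fun D u.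
Proof. by move=> iu; apply/measurable_EFinP; exact: (measurable_int mu iu). Qed.

Lemma continuous_bounded_I (b : R -> R) : continuous b ->
  exists2 K : R, 0 < K & forall x, I01 R x -> `|b x| <= K.
Proof.
move=> cb.
have : compact (b @` I01 R).
  apply: continuous_compact; last exact: segment_compact.
  exact: continuous_subspaceT.
move=> /compact_bounded/pinfty_ex_gt0[K K0 bK]; exists K => // x Ix.
by apply: bK; exists x.
Qed.

Lemma integrableZ_I (k : R) (u : R -> R) :
  mu.-integrable (I01 R) (EFin \o u) ->
  mu.-integrable (I01 R) (EFin \o (fun x => k * u x)).
Proof. exact: (integrableZl measurable_I01 k). Qed.

Lemma integrableD_I (u v : R -> R) :
  mu.-integrable (I01 R) (EFin \o u) -> mu.-integrable (I01 R) (EFin \o v) ->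
  mu.-integrable (I01 R) (EFin \o (fun x => u x + v x)).
Proof. exact: (integrableD measurable_I01). Qed.

Lemma integrableB_I (u v : R -> R) :
  mu.-integrable (I01 R) (EFin \o u) -> mu.-integrable (I01 R) (EFin \o v) ->
  mu.-integrable (I01 R) (EFin \o (fun x => u x - v x)).
Proof.
move=> iu iv; have := integrableB measurable_I01 iu iv.
by apply: (eq_integrable measurable_I01) => x _ /=; rewrite EFinB.
Qed.

Lemma integrableM_continuous (u b : R -> R) :
  mu.-integrable (I01 R) (EFin \o u) -> continuous b ->
  mu.-integrable (I01 R) (EFin \o (fun x => u x * b x)).
Proof.
move=> iu cb; have [K K0 bK] := continuous_bounded_I cb.
have iKu : mu.-integrable (I01 R) (fun x => (K * u x)%:E).
  exact: (integrableZl measurable_I01 K iu).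
apply: (le_integrable measurable_I01 _ _ iKu).
  apply/measurable_EFinP/measurable_funM.
    exact: integrable_measurable_fun.
  apply: measurable_funTS; exact: continuous_measurable_fun.
move=> x Ix /=; rewrite lee_fin !normrM mulrC ler_wpM2r// (le_trans (bK _ Ix))//.
exact: ler_norm.
Qed.

(** Two separate estimates: replacing [u t] by [u s] costs at most a local bound of [a] times the
    [L^1] distance, and for the fixed integrable [u s] dominated convergence moves the weight from
    time [t] to time [s]. *)
Lemma pairing_continuous (u : R -> R -> R) (a : R * R -> R) :
  (forall t, mu.-integrable (I01 R) (EFin \o u t)) ->
  (forall s, L1dist_I (u t) (u s) @[t --> s] --> 0%E) ->
  continuous a ->
  continuous (fun t => \int[mu]_(x in I01 R) (u t x * a (x, t))).
Proof.
move=> iu cu ca s.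
have ca1 t : continuous (fun x => a (x, t)).
  move=> x; apply: (@continuous_comp _ _ _ (fun x => (x, t)) a); last exact: ca.
  by apply: continuous_pair => y; [exact: cvg_id|exact: cvg_cst].
have ca2 x : continuous (fun t => a (x, t)).
  move=> t; apply: (@continuous_comp _ _ _ (fun t => (x, t)) a); last exact: ca.
  by apply: continuous_pair => y; [exact: cvg_cst|exact: cvg_id].
have [K K0 aK] : exists2 K : R, 0 < K &
    forall x t, I01 R x -> `[s - 1, s + 1]%classic t -> `|a (x, t)| <= K.
  have : compact (a @` (I01 R `*` `[s - 1, s + 1])).
    apply: continuous_compact; first exact: continuous_subspaceT.
    by apply: compact_setX; exact: segment_compact.
  move=> /compact_bounded/pinfty_ex_gt0[K K0 aK]; exists K => // x t Ix It.
  by apply: aK; exists (x, t).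
have iua t r : mu.-integrable (I01 R) (EFin \o (fun x => u t x * a (x, r))).
  exact: integrableM_continuous.
have c2 : \int[mu]_(x in I01 R) (u s x * a (x, t)) @[t --> s] -->
    \int[mu]_(x in I01 R) (u s x * a (x, s)).
  have iKu : mu.-integrable (I01 R) (EFin \o (fun x => K * `|u s x|)).
    exact/integrableZ_I/integrable_norm.
  apply: (@continuity_under_integral R _ _ mu (fun t x => u s x * a (x, t))
    (I01 R) measurable_I01 (s - 1) (s + 1) _ _ _ iKu) => //.
  - by apply: aeW => x _ t _; apply: cvgMr; exact: ca2.
  - move=> t; rewrite /= in_itv/= => /andP[st ts]; apply: aeW => x Ix.
    by rewrite normrM mulrC ler_wpM2r// aK//= in_itv/= !ltW.
  - by rewrite inE/= in_itv/=; lra.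
apply/cvgrPdist_lt => e e0.
have e20 : 0 < e / 2 by rewrite divr_gt0.
have eK0 : 0 < e / 2 / K by rewrite divr_gt0.
move/cvgrPdist_lt : c2 => /(_ _ e20) c2.
have c1 : \forall t \near s, (L1dist_I (u t) (u s) < (e / 2 / K)%:E)%E.
  apply: (cu s [set y | (y < (e / 2 / K)%:E)%E]).
  by apply: open_ereal_lt'; rewrite lte_fin.
near=> t.
have st : `[s - 1, s + 1]%classic t.
  have : `|s - t| < 1 by near: t; apply: cvgr_dist_lt => //; exact: cvg_id.
  by rewrite ltr_norml /= in_itv/= => /andP[? ?]; lra.
have i1 : mu.-integrable (I01 R) (EFin \o (fun x => u t x - u s x)).
  exact: integrableB_I.
have i2 : mu.-integrable (I01 R) (EFin \o (fun x => (u t x - u s x) * a (x, t))).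
  exact: integrableM_continuous.
have -> : \int[mu]_(x in I01 R) (u t x * a (x, t)) =
    \int[mu]_(x in I01 R) ((u t x - u s x) * a (x, t)) +
    \int[mu]_(x in I01 R) (u s x * a (x, t)).
  by rewrite -RintegralD//; [apply: eq_Rintegral => x _; ring|exact: measurable_I01].
rewrite opprD addrCA addrC (le_lt_trans (ler_normD _ _))// [e]splitr ltrD//.
  by near: t.
rewrite normrN.
apply: (le_lt_trans (le_normr_Rintegral measurable_I01 i2)).
apply: (@le_lt_trans _ _ (\int[mu]_(x in I01 R) (K * `|u t x - u s x|))).
  apply: le_Rintegral => //.
  - exact: measurable_I01.
  - exact: integrable_norm.
  - exact/integrableZ_I/integrable_norm.
  - by move=> x Ix; rewrite normrM mulrC ler_wpM2r// aK.
rewrite RintegralZl; [|exact: measurable_I01|exact: integrable_norm].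
rewrite mulrC -ltr_pdivlMr// -lte_fin /Rintegral fineK.
  by near: t.
apply: integrable_fin_num; first exact: measurable_I01.
exact: integrable_norm.
Unshelve. all: by end_near. Qed.

End pairing.
Arguments measurable_I01 {R}.

(** * Almost-everywhere bounds from averages *)

Section averages.
Variable R : realType.
Local Notation mu := (@lebesgue_measure R).

Lemma negligible_I01_boundary :
  {ae mu, forall x : R, I01 R x -> 0 < x < 1}.
Proof.
have neq a : {ae mu, forall x : R, x != a}.
  exists [set a]; split; [exact: measurable_set1|exact: lebesgue_measure_set1|].
  by move=> x /= /negP; rewrite negbK => /eqP.
have aeF := ae_filter_ringOfSetsType mu.
apply: filterS2 (neq 0) (neq 1) => x x0 x1; rewrite /I01/= in_itv/=.
by rewrite !lt_neqAle x1 eq_sym x0.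
Qed.

(** Lebesgue differentiation: at almost every [x], the value [g x] is the limit of the averages of
    [g] over [[x, z]] as [z] decreases to [x]. *)
Lemma ae_le_of_average_le (g : R -> R) (M : R) :
  mu.-integrable (I01 R) (EFin \o g) ->
  (forall a b : R, 0 < a -> a < b -> b < 1 ->
    \int[mu]_(x in `[a, b]) g x <= M * (b - a)) ->
  {ae mu, forall x, I01 R x -> g x <= M}.
Proof.
move=> ig avg.
pose f := g \_ (I01 R).
have iF : mu.-integrable setT (EFin \o f).
  rewrite /f -restrict_EFin.
  have [+ _] := integrable_restrict mu measurable_I01 measurableT (EFin \o g).
  by rewrite setTI; apply.
have iFitv (i : interval R) : mu.-integrable [set` i] (EFin \o f).
  by apply: integrableS iF => //; exact: measurable_itv.
have := @FTC1 R f (BLeft 0) (fun y => iFitv _) (integrable_locally measurable_I01 ig).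
pose F x := \int[mu]_(t in `[0, x]) f t.
have aeF := ae_filter_ringOfSetsType mu.
rewrite -/F; apply: filterS2 negligible_I01_boundary => x x01 dF Ix.
have /andP[x0 x1] := x01 Ix.
(* In Caratheodory's form of the derivative, [q] is the difference quotient of [F] based at [x], so
   a bound on [q z] for [z > x] passes to the limit [q x = g x]. *)
have {dF} /is_derive_of_derive1/is_derive1_caratheodory [q [Fq cq qx]] :
    derivable F x 1 /\ F^`()%classic x = f x.
  by apply: dF; rewrite /= lte_fin.
have -> : g x = q x by rewrite qx /f patchE mem_set.
apply: (@cvgr_to_le _ (x^'+) _ _ q); first by apply: cvg_at_right_filter; exact: cq.
near=> z.
have xz : x < z by near: z; exact: nbhs_right_gt.
have z1 : z < 1 by near: z; exact: nbhs_right_lt.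
rewrite -(ler_pM2r (_ : 0 < z - x)) ?subr_gt0// -Fq.
apply: le_trans (avg _ _ x0 xz z1).
have := @Rintegral_itvB R f (BLeft 0) (BRight z) x (iFitv _).
rewrite !bnd_simp => /(_ (ltW x0) (ltW xz)) ->.
rewrite Rintegral_itv_obnd_cbnd; last exact: iFitv.
rewrite le_eqVlt; apply/orP; left; apply/eqP; apply: eq_Rintegral => y.
rewrite inE/= in_itv/= => /andP[xy yz].
rewrite /f patchE mem_set// /I01/= in_itv/=; lra.
Unshelve. all: by end_near. Qed.

End averages.

(** * Test functions on the circle R / 2Z *)

Section circle_tests.
Variable R : realType.
Local Notation mu := (@lebesgue_measure R).

(** The derivative is explicit data because each test enters the weak formulation together with it.
    The bound on [th'] makes [th] Lipschitz, which controls the odd wave at the boundary. *)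
Record circle_test (th th' : R -> R) : Prop := CircleTest {
  circle_periodic : forall y, th (y + 2) = th y ;
  circle_derive : forall y : R, is_derive y 1 th (th' y) ;
  circle_continuous_derive : continuous th' ;
  circle_lipschitz : exists L : R, forall y, `|th' y| <= L }.

Lemma circle_continuous th th' : circle_test th th' -> continuous th.
Proof. by move=> T; exact: is_derive_continuous (circle_derive T). Qed.

Lemma is_derive_comp_sub (f f' : R -> R) (c : R) :
  (forall y : R, is_derive y 1 f (f' y)) ->
  forall y : R, is_derive y 1 (fun y => f (y - c)) (f' (y - c)).
Proof.
move=> df y; rewrite -[f' _]mulr1.
apply: (@is_derive1_comp _ f (fun y => y - c)).
by apply: is_derive_eq; rewrite subr0.
Qed.

Lemma is_derive_comp_refl (f f' : R -> R) (c : R) :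
  (forall y : R, is_derive y 1 f (f' y)) ->
  forall y : R, is_derive y 1 (fun y => f (- y - c)) (- f' (- y - c)).
Proof.
move=> df y; rewrite -[- f' _]mulrN1.
apply: (@is_derive1_comp _ f (fun y => - y - c)).
by apply: is_derive_eq; rewrite subr0.
Qed.

Lemma circle_test_reflect th th' c : circle_test th th' ->
  circle_test (fun y => th (- y - c)) (fun y => - th' (- y - c)).
Proof.
move=> [per dth cth' [L thL]]; split.
- by move=> y; rewrite -[LHS]per; congr th; ring.
- exact: is_derive_comp_refl.
- move=> y; apply: cvgN; apply: (@continuous_comp _ _ _ (fun y => - y - c) th').
    by apply: cvgB; [apply: cvgN; exact: cvg_id|exact: cvg_cst].
  exact: cth'.
- by exists L => y; rewrite normrN.
Qed.

Section arc_bump.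
Variables a b : R.
Let k : R := pi / 2.
(** The factors vanish exactly at [a] and at [b] modulo 2. For [0 < a < b < 1] the product is
    therefore positive precisely on the arc []a, b[] of the circle, and [arc_bump n] increases to
    the indicator of that arc as [n] grows. *)
Let p (y : R) := sin (k * (y - a)) * sin (k * (b - y)).
Let p' (y : R) := k * (cos (k * (y - a)) * sin (k * (b - y))
                    - sin (k * (y - a)) * cos (k * (b - y))).

(* [p] is 2-periodic because each of its factors is 2-antiperiodic. *)
Definition arc_bump (n : nat) (y : R) : R :=
  1 - (1 + n%:R * pospart (p y) ^+ 2)^-1.

Let arc_bump' (n : nat) (y : R) : R :=
  n%:R * (2 * pospart (p y) * p' y) / (1 + n%:R * pospart (p y) ^+ 2) ^+ 2.

Let den_ge1 n y : 1 <= 1 + n%:R * pospart (p y) ^+ 2.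
Proof. by rewrite lerDl mulr_ge0// sqr_ge0. Qed.

Let dp (y : R) : is_derive y 1 p (p' y).
Proof.
rewrite /p.
have d1 : is_derive y 1 (fun y => sin (k * (y - a))) (cos (k * (y - a)) * k).
  apply: (@is_derive1_comp _ sin (fun y => k * (y - a))).
  by apply: is_derive_eq; rewrite /GRing.scale/=; ring.
have d2 : is_derive y 1 (fun y => sin (k * (b - y))) (cos (k * (b - y)) * - k).
  apply: (@is_derive1_comp _ sin (fun y => k * (b - y))).
  by apply: is_derive_eq; rewrite /GRing.scale/=; ring.
apply: (is_derive_eq (is_deriveM d1 d2)).
by rewrite /GRing.scale/= /p'; ring.
Qed.

Let continuous_p : continuous p := is_derive_continuous dp.

Let continuous_p' : continuous p'.
Proof.
have ck1 : continuous (fun y => k * (y - a)).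
  by move=> y; apply: cvgMr; apply: cvgB; [exact: cvg_id|exact: cvg_cst].
have ck2 : continuous (fun y => k * (b - y)).
  by move=> y; apply: cvgMr; apply: cvgB; [exact: cvg_cst|exact: cvg_id].
have c1 : continuous (fun y => cos (k * (y - a))).
  by move=> y; apply: continuous_comp; [exact: ck1|exact: continuous_cos].
have c2 : continuous (fun y => cos (k * (b - y))).
  by move=> y; apply: continuous_comp; [exact: ck2|exact: continuous_cos].
have s1 : continuous (fun y => sin (k * (y - a))).
  by move=> y; apply: continuous_comp; [exact: ck1|exact: continuous_sin].
have s2 : continuous (fun y => sin (k * (b - y))).
  by move=> y; apply: continuous_comp; [exact: ck2|exact: continuous_sin].
move=> y; apply: cvgMr; apply: cvgB; apply: cvgM;
  [exact: c1|exact: s2|exact: s1|exact: c2].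
Qed.

Let norm_p_le1 y : `|p y| <= 1.
Proof. by rewrite /p normrM mulr_ile1// ler_norml sin_geN1 sin_le1. Qed.

Let norm_p'_le y : `|p' y| <= pi.
Proof.
have s z : `|sin z| <= 1 :> R by rewrite ler_norml sin_geN1 sin_le1.
have c z : `|cos z| <= 1 :> R by rewrite ler_norml cos_geN1 cos_le1.
have k0 : 0 <= k by rewrite divr_ge0// pi_ge0.
rewrite /p' normrM (ger0_norm k0) [leRHS](_ : _ = k * (1 + 1)); last first.
  by rewrite /k; field.
rewrite ler_wpM2l// (le_trans (ler_normB _ _))// lerD// normrM mulr_ile1//.
Qed.

Let p_periodic y : p (y + 2) = p y.
Proof.
rewrite /p (_ : k * (y + 2 - a) = k * (y - a) + pi); last by rewrite /k; field.
rewrite (_ : k * (b - (y + 2)) = k * (b - y) - pi); last by rewrite /k; field.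
by rewrite sinDpi sinB cospi sinpi mulr0 subr0 mulrN1 mulrNN.
Qed.

Lemma arc_bump_ge0 n y : 0 <= arc_bump n y.
Proof. by rewrite /arc_bump subr_ge0 invf_le1 ?(lt_le_trans ltr01). Qed.

Lemma arc_bump_le1 n y : arc_bump n y <= 1.
Proof. by rewrite /arc_bump lerBlDr lerDl invr_ge0 (le_trans ler01). Qed.

Lemma circle_test_arc_bump n : circle_test (arc_bump n) (arc_bump' n).
Proof.
have dsq (y : R) : is_derive y 1 (fun y => pospart (p y) ^+ 2) (2 * pospart (p y) * p' y).
  apply: (@is_derive1_comp _ (fun z => pospart z ^+ 2) p); last exact: dp.
  exact: is_derive_sqr_pospart.
have csq := is_derive_continuous dsq.
have den0 y : 1 + n%:R * pospart (p y) ^+ 2 != 0.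
  by rewrite gt_eqF// (lt_le_trans ltr01).
have cden : continuous (fun y => 1 + n%:R * pospart (p y) ^+ 2).
  by move=> y; apply: cvgD; [exact: cvg_cst|apply: cvgMr; exact: csq].
split.
- by move=> y; rewrite /arc_bump p_periodic.
- move=> y; rewrite /arc_bump.
  have dden : is_derive y 1 (fun y => 1 + n%:R * pospart (p y) ^+ 2)
      (n%:R * (2 * pospart (p y) * p' y)).
    have := is_deriveD (is_derive_cst (1 : R) (y : R) (1 : R)) (is_deriveZ n%:R (dsq y)).
    by rewrite add0r.
  have dinv := @is_deriveV _ (fun y => 1 + n%:R * pospart (p y) ^+ 2) _ _ _ (den0 y) dden.
  have := is_deriveB (is_derive_cst (1 : R) (y : R) (1 : R)) dinv.
  by rewrite /arc_bump' sub0r /GRing.scale/= mulNr opprK mulrC.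
- move=> y; rewrite /arc_bump'; apply: cvgM.
    apply: cvgMr; apply: cvgM; last exact: continuous_p'.
    apply: cvgMr; apply: continuous_comp; first exact: continuous_p.
    exact: continuous_pospart.
  apply: cvgV; first by rewrite expf_neq0.
  have := cvgM (cden y) (cden y); exact.
- exists (n%:R * (2 * 1 * pi)) => y; rewrite /arc_bump'.
  rewrite normrM normfV ler_pdivrMr ?normr_gt0 ?expf_neq0//.
  rewrite -[leLHS]mulr1 ler_pM ?normr_ge0//.
  + rewrite normrM normr_nat ler_wpM2l// normrM ler_pM//.
    rewrite normrM (ger0_norm (ler0n _ _)) ler_wpM2l// ger0_norm ?pospart_ge0//.
    have [p0|/ltW p0] := leP 0 (p y); last by rewrite pospart_eq0.
    by rewrite pospart_id// (le_trans (ler_norm _)).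
  + by rewrite normrX exprn_ege1// ger0_norm// (le_trans ler01).
Qed.

Let sin_pos (z : R) : 0 < z < 2 -> 0 < sin (k * z).
Proof.
move=> /andP[z0 z2]; have k0 : 0 < k by rewrite divr_gt0// pi_gt0.
rewrite sin_gt0_pi// mulr_gt0//= (_ : pi = k * 2); last by rewrite /k; field.
by rewrite ltr_pM2l.
Qed.

Let sin_neg (z : R) : -2 < z <= 0 -> sin (k * z) <= 0.
Proof.
move=> /andP[z2]; rewrite le_eqVlt => /predU1P[->|z0]; first by rewrite mulr0 sin0.
rewrite -[z]opprK mulrN sinN oppr_le0 ltW// sin_pos//. by rewrite oppr_gt0 z0 ltrNl.
Qed.

Lemma arc_bump_out n (x : R) : 0 < a -> a < b -> b < 1 ->
  0 <= x <= 1 -> ~ (a < x < b) -> arc_bump n x = 0.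
Proof.
move=> a0 ab b1 /andP[x0 x1] xab.
have p0 : p x <= 0.
  have [xa|ax] := leP x a.
    by apply: mulr_le0_ge0; [apply: sin_neg|apply/ltW/sin_pos]; lra.
  have [bx|xb] := leP b x; last by exfalso; apply: xab; rewrite ax.
  by apply: mulr_ge0_le0; [apply/ltW/sin_pos|apply: sin_neg]; lra.
by rewrite /arc_bump pospart_eq0// expr0n mulr0 addr0 invr1 subrr.
Qed.

Lemma arc_bump_opp n (x : R) : 0 < a -> a < b -> b < 1 ->
  0 <= x <= 1 -> arc_bump n (- x) = 0.
Proof.
move=> a0 ab b1 /andP[x0 x1].
have p0 : p (- x) <= 0.
  by apply: mulr_le0_ge0; [apply: sin_neg|apply/ltW/sin_pos]; lra.
by rewrite /arc_bump pospart_eq0// expr0n mulr0 addr0 invr1 subrr.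
Qed.

Lemma arc_bump_cvg (x : R) : 0 < a -> a < b -> b < 1 ->
  a < x < b -> arc_bump n x @[n --> \oo] --> (1 : R).
Proof.
move=> a0 ab b1 /andP[ax xb].
have p0 : 0 < p x by rewrite mulr_gt0// sin_pos//; lra.
rewrite /arc_bump -[X in _ --> X]subr0; apply: cvgB; first exact: cvg_cst.
have q0 : 0 < pospart (p x) ^+ 2 by rewrite pospart_id ?exprn_gt0// ltW.
apply/cvgrPdist_lt => e e0; near=> n.
rewrite sub0r normrN ger0_norm ?invr_ge0 ?(le_trans ler01)//.
rewrite invf_plt ?posrE// ?(lt_le_trans ltr01)//.
rewrite (@lt_le_trans _ _ (n%:R * pospart (p x) ^+ 2)) ?lerDr//.
rewrite -ltr_pdivrMr//; near: n; exact: nbhs_infty_gtr.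
Unshelve. all: by end_near. Qed.

End arc_bump.

End circle_tests.

Section ae_tests.
Variable R : realType.
Local Notation mu := (@lebesgue_measure R).

(** Bumps on arcs []a, b[] inside []0, 1[] vanish on [[-1, 0]], so the terms with [h] drop out.
    Letting the bumps tend to the indicator of the arc bounds the averages of [g]. *)
Lemma ae_le_of_circle_tests (g h : R -> R) (M : R) :
  mu.-integrable (I01 R) (EFin \o g) -> mu.-integrable (I01 R) (EFin \o h) ->
  (forall th th', circle_test th th' -> (forall y, 0 <= th y <= 1) ->
    \int[mu]_(x in I01 R) (g x * th x + h x * th (- x)) <=
    M * \int[mu]_(x in I01 R) (th x + th (- x))) ->
  {ae mu, forall x, I01 R x -> g x <= M}.
Proof.
move=> ig ih H; apply: ae_le_of_average_le => // a b a0 ab b1.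
have igM : mu.-integrable (I01 R) (EFin \o (fun x => g x - M)).
  apply: integrableB_I => //.
  exact/continuous_integrable_itv/cst_continuous.
have cbump n : continuous (arc_bump a b n) := circle_continuous (circle_test_arc_bump a b n).
have ifn n : mu.-integrable (I01 R) (EFin \o (fun x => (g x - M) * arc_bump a b n x)).
  exact: integrableM_continuous.
have le0 n : \int[mu]_(x in I01 R) ((g x - M) * arc_bump a b n x) <= 0.
  have b01 y : 0 <= arc_bump a b n y <= 1 by rewrite arc_bump_ge0 arc_bump_le1.
  have := H _ _ (circle_test_arc_bump a b n) b01.
  rewrite -subr_le0; apply: le_trans.
  have bN x : x \in I01 R -> arc_bump a b n (- x) = 0.
    by rewrite inE /I01/= in_itv/= => x01; exact: arc_bump_opp.
  under [X in _ <= X - _]eq_Rintegral do rewrite bN// mulr0 addr0.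
  under [X in _ <= _ - _ * X]eq_Rintegral do rewrite bN// addr0.
  rewrite -RintegralZl; [|exact: measurable_I01|exact: continuous_integrable_itv].
  rewrite -RintegralB; [|exact: measurable_I01|exact: integrableM_continuous|].
    rewrite le_eqVlt; apply/orP; left; apply/eqP.
    by apply: eq_Rintegral => x _; rewrite mulrBl.
  exact/integrableZ_I/continuous_integrable_itv.
pose f : R -> R := (fun x => g x - M) \_ `]a, b[.
have cvgf : \int[mu]_(x in I01 R) ((g x - M) * arc_bump a b n x) @[n --> \oo] -->
    \int[mu]_(x in I01 R) f x.
  apply: (@Rintegral_dominated_cvg R _ _ mu (I01 R) _ f (fun x => `|g x - M|)).
  - exact: measurable_I01.
  - by move=> n; exact: integrable_measurable_fun.
  - move=> x Ix; rewrite /f patchE; case: ifPn => [|xab].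
      rewrite inE/= in_itv/= => xab; rewrite -[X in _ --> X]mulr1.
      by apply: cvgMr; exact: arc_bump_cvg.
    have -> : (fun n => (g x - M) * arc_bump a b n x) = fun=> 0.
      apply/funext => n; rewrite arc_bump_out ?mulr0//.
      by move=> xab'; move: xab; rewrite notin_setE/= in_itv/=.
    exact: cvg_cst.
  - exact: integrable_norm.
  - move=> n x Ix; rewrite normrM -[leRHS]mulr1 ler_wpM2l// ger0_norm ?arc_bump_ge0//.
    exact: arc_bump_le1.
have abI : `[a, b]%classic `<=` I01 R.
  by move=> x; rewrite /I01/= !in_itv/=; lra.
have : \int[mu]_(x in I01 R) f x <= 0.
  by apply: (cvgr_to_le cvgf); apply: nearW => n; exact: le0.
rewrite /f -Rintegral_mkcondr (_ : I01 R `&` `]a, b[ = `]a, b[%classic); last first.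
  apply/seteqP; split => [x []//|x xab]; split => //; apply: abI.
  exact: subset_itv_oo_cc xab.
have igMab : mu.-integrable `[a, b] (EFin \o (fun x => g x - M)).
  by apply: integrableS igM => //; exact: measurable_itv.
have igab : mu.-integrable `[a, b] (EFin \o g).
  by apply: integrableS ig => //; exact: measurable_itv.
rewrite Rintegral_itv_bndo_bndc; last first.
  by apply: integrableS igMab => //; exact: subset_itv_oo_cc.
rewrite Rintegral_itv_obnd_cbnd; last first.
  by apply: integrableS igMab => //; exact: subset_itv_oc_cc.
rewrite RintegralB//; last exact/continuous_integrable_itv/cst_continuous.
by rewrite Rintegral_cst//= lebesgue_measure_itv/= lte_fin ab/= subr_le0.
Qed.

End ae_tests.

(** * Maximum principle and contraction *)

Section dynamics.
Variable R : realType.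
Implicit Types (th : R -> R) (t : R).

Definition reflect_test (c : R) th : R -> R := fun y => th (- y - c).

(** Values in [[0, 1]] make the bounds on pairings uniform over the class, and reflections preserve
    the class, so the iteration may replace a test by its reflections. *)
Definition unit_test th th' := circle_test th th' /\ forall y, 0 <= th y <= 1.

Lemma unit_test_reflect (c : R) th th' : unit_test th th' ->
  unit_test (reflect_test c th) (fun y => - th' (- y - c)).
Proof. by move=> [T th01]; split; [exact: circle_test_reflect|move=> y; exact: th01]. Qed.

(** An axiomatic form of the evolution of [W], with [m] the mass of a test. It is stable under
    [X := - X], so each upper bound derived from it is also a lower bound. The function [N] in
    [rt_bounded] is common to all tests. *)
Record reflected_transport (d : R) (X : (R -> R) -> R -> R) (m : (R -> R) -> R) : Prop :=
  ReflectedTransport {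
  rt_continuous : forall th th', unit_test th th' -> continuous (X th) ;
  rt_derive : forall th th', unit_test th th' -> forall t : R, 0 < t ->
    is_derive t 1 (X th) (d * (X (reflect_test (2 * t) th) t - X th t)) ;
  rt_bounded : exists2 N : R -> R, continuous N &
    forall th th', unit_test th th' -> forall t, `|X th t| <= N t ;
  rt_mass : forall c th th', unit_test th th' -> m (reflect_test c th) = m th ;
  rt_mass_bound : forall th th', unit_test th th' -> 0 <= m th <= 2 }.

Lemma reflected_transportN d X m : reflected_transport d X m ->
  reflected_transport d (fun th t => - X th t) m.
Proof.
move=> [cX dX [N cN XN] mR mB]; split => //.
- by move=> th th' T t; apply: cvgN; exact: (cX _ _ T).
- move=> th th' T t t0.
  rewrite (_ : d * _ = - (d * (X (reflect_test (2 * t) th) t - X th t))); last ring.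
  by apply: is_deriveN; exact: (dX _ _ T).
- by exists N => // th th' T t; rewrite normrN; exact: (XN _ _ T).
Qed.

Section maximum_principle.
Variables (d : R) (X : (R -> R) -> R -> R) (m : (R -> R) -> R).

(* Iterating the Duhamel formula: each iteration halves the constant. *)
Lemma maximum_principle_iter (M N t0 T : R) : 0 <= d -> 0 <= t0 -> 0 <= N ->
  reflected_transport d X m ->
  (forall th th', unit_test th th' -> X th t0 <= M * m th) ->
  (forall th th', unit_test th th' -> forall t, t0 <= t <= T -> X th t - M * m th <= N) ->
  forall n th th', unit_test th th' -> forall t, t0 <= t <= T ->
    expR (d * t) * (X th t - M * m th) <= N * 2^-1 ^+ n * expR (2 * d * t).
Proof.
move=> d0 t00 N0 rt le0 leN; elim=> [|n IH] th th' Tth t tT.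
  rewrite expr0 mulr1 (_ : 2 * d * t = d * t + d * t); last ring.
  rewrite expRD mulrCA ler_pM2l ?expR_gt0//.
  apply: (le_trans (leN _ _ Tth _ tT)); rewrite ler_peMr// -expR0 ler_expR mulr_ge0//.
  by rewrite (le_trans t00)//; case/andP: tT.
(* The weight [expR (d * s)] absorbs the loss term. The gain is bounded by induction, and since
   [d * expR (2 * d * s)] is the derivative of [expR (2 * d * s) / 2], integrating it yields the new
   factor [2^-1]. *)
pose g s := expR (d * s) * (X th s - M * m th) -
  N * 2^-1 ^+ n.+1 * expR (2 * d * s).
pose g' s := d * (expR (d * s) * (X (reflect_test (2 * s) th) s - M * m th) -
  N * 2^-1 ^+ n * expR (2 * d * s)).
have /andP[t0t tleT] := tT.
have dexp (c s : R) : is_derive s 1 (fun s => expR (c * s)) (expR (c * s) * c).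
  apply: (@is_derive1_comp _ expR (fun s => c * s)).
  by apply: is_derive_eq; rewrite /GRing.scale/= mulr1.
suff : g t <= g t0.
  rewrite /g => h; rewrite -subr_le0; apply: (le_trans h).
  rewrite subr_le0 (@le_trans _ _ 0)//.
    by rewrite mulr_ge0_le0 ?expR_ge0// subr_le0 (le0 _ _ Tth).
  by rewrite !mulr_ge0 ?expR_ge0// exprn_ge0// invr_ge0.
apply: (@derive_le0_le _ g g' t0 t); last exact: t0t.
- move=> s; apply: cvgB; last first.
    by apply: cvgMr; exact: (is_derive_continuous (dexp (2 * d))).
  apply: cvgM; first exact: (is_derive_continuous (dexp d)).
  by apply: cvgB; [exact: (rt_continuous rt Tth)|exact: cvg_cst].
- move=> s t0s.
  have dX := rt_derive rt Tth (le_lt_trans t00 t0s).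
  have := is_deriveB
    (is_deriveM (dexp d s) (is_deriveB dX (is_derive_cst (M * m th) (s : R) (1 : R))))
    (is_deriveZ (N * 2^-1 ^+ n.+1) (dexp (2 * d) s)).
  move=> h; apply: (is_derive_eq h); rewrite /GRing.scale/= /g' exprS !fctE; by field.
- move=> s t0s st; rewrite /g'; apply: mulr_ge0_le0; first exact: d0.
  rewrite subr_le0.
  rewrite -(rt_mass rt (2 * s) Tth); apply: (IH _ _ (unit_test_reflect (2 * s) Tth)).
  by rewrite (ltW t0s) (le_trans (ltW st) tleT).
Qed.

(** A crude bound on [[t0, t]] starts the iteration, whose constant then tends to zero. The starting
    time is arbitrary because the principle is applied from time [0] and again from time [1]. *)
Lemma maximum_principle (M t0 : R) : 0 <= d -> 0 <= t0 ->
  reflected_transport d X m ->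
  (forall th th', unit_test th th' -> X th t0 <= M * m th) ->
  forall th th', unit_test th th' -> forall t, t0 <= t -> X th t <= M * m th.
Proof.
move=> d0 t00 rt le0 th th' Tth t t0t.
have [N cN XN] := rt_bounded rt.
have [K K0 NK] : exists2 K : R, 0 < K & forall s, t0 <= s <= t -> `|N s| <= K.
  have : compact (N @` `[t0, t]).
    by apply: continuous_compact; [exact: continuous_subspaceT|exact: segment_compact].
  move=> /compact_bounded/pinfty_ex_gt0[K K0 NK]; exists K => // s st.
  by apply: NK; exists s => //=; rewrite in_itv.
have leK th1 th1' : unit_test th1 th1' -> forall s, t0 <= s <= t ->
    X th1 s - M * m th1 <= K + `|M| * 2.
  move=> T1 s st; rewrite (le_trans (ler_norm _))// (le_trans (ler_normB _ _))//.
  rewrite lerD//.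
    by rewrite (le_trans (XN _ _ T1 s))// (le_trans (ler_norm _))// NK.
  have /andP[m0 m2] := rt_mass_bound rt T1.
  by rewrite normrM ler_wpM2l// ger0_norm.
have KM0 : 0 <= K + `|M| * 2 by rewrite addr_ge0 ?mulr_ge0// ltW.
have it n := maximum_principle_iter d0 t00 KM0 rt le0 leK n Tth.
have tt : t0 <= t <= t by rewrite t0t lexx.
have : expR (d * t) * (X th t - M * m th) <= 0.
  apply: (@cvgr_to_ge _ \oo _ _
    (fun n => (K + `|M| * 2) * 2^-1 ^+ n * expR (2 * d * t))); last first.
    by apply: nearW => n; exact: it.
  rewrite -[X in _ --> X](mul0r (expR (2 * d * t))); apply: cvgMl.
  rewrite -[X in _ --> X](mulr0 (K + `|M| * 2)); apply: cvgMr.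
  by apply: cvg_expr; rewrite ger0_norm ?invf_lt1// ?ltr1n// invr_ge0.
by rewrite pmulr_rle0 ?expR_gt0// subr_le0.
Qed.

End maximum_principle.

Section contraction.
Variables (d : R) (X : (R -> R) -> R -> R) (m : (R -> R) -> R) (K : R).

(** Reflection preserves the mass, so gain and loss are each at most [d * K * m th] in absolute
    value. *)
Lemma transport_variation : 0 <= d -> reflected_transport d X m ->
  (forall th th', unit_test th th' -> forall t, 0 <= t -> `|X th t| <= K * m th) ->
  forall th th', unit_test th th' -> forall t, 0 <= t ->
  X th t <= X th 0 + 2 * d * K * m th * t.
Proof.
move=> d0 rt XK th th' Tth t t0.
pose g s := X th s - 2 * d * K * m th * s.
suff : g t <= g 0 by rewrite /g mulr0 subr0 lerBlDr.
apply: (@derive_le0_le _ g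
  (fun s => d * (X (reflect_test (2 * s) th) s - X th s) - 2 * d * K * m th)); last exact: t0.
- move=> s; apply: cvgB; first exact: (rt_continuous rt Tth).
  by apply: cvgMr; exact: cvg_id.
- move=> s s0.
  have := is_deriveB (rt_derive rt Tth s0)
    (is_deriveZ (2 * d * K * m th) (is_derive_id (s : R) (1 : R))).
  by move=> h; apply: (is_derive_eq h); rewrite /GRing.scale/= mulr1.
- move=> s s0 _.
  have := XK _ _ Tth s (ltW s0).
  have := XK _ _ (unit_test_reflect (2 * s) Tth) s (ltW s0).
  rewrite (rt_mass rt _ Tth) !ler_norml => /andP[_ h1] /andP[h2 _].
  rewrite (_ : _ - _ = d * ((X (reflect_test (2 * s) th) s - K * m th) -
    (X th s + K * m th))); last ring.
  rewrite mulr_ge0_le0//; lra.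
Qed.

End contraction.

(** The hypothesis on [Z] says that the gain computed from the initial value integrates to zero over
    [[0, 1]]. If [X] on the right of the equation were frozen at time [0], the value at time [1]
    would be exactly [(1 - d) * X th 0]. At time [s], freezing alters [X] by at most
    [2 * d * K * m th * s], in the gain and in the loss; the resulting rate
    [4 * d ^+ 2 * K * m th * s] integrates to the error term. *)
Lemma transport_contraction (d : R) (X : (R -> R) -> R -> R) m (K M : R) :
  0 <= d -> d <= 1 -> reflected_transport d X m ->
  (forall th th', unit_test th th' -> forall t, 0 <= t -> `|X th t| <= K * m th) ->
  (forall th th', unit_test th th' -> X th 0 <= M * m th) ->
  (forall th th', unit_test th th' -> exists2 Z : R -> R, Z 1 = Z 0 &
     forall s : R, is_derive s 1 Z (X (reflect_test (2 * s) th) 0)) ->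
  forall th th', unit_test th th' ->
  X th 1 <= ((1 - d) * M + 2 * d ^+ 2 * K) * m th.
Proof.
move=> d0 d1 rt XK XM hZ th th' Tth.
have [Z Z10 dZ] := hZ _ _ Tth.
have up := transport_variation d0 rt XK.
have XKN th1 th1' : unit_test th1 th1' -> forall t, 0 <= t -> `|- X th1 t| <= K * m th1.
  by move=> T1 t t0; rewrite normrN; exact: (XK _ _ T1).
have lo := transport_variation d0 (reflected_transportN rt) XKN.
pose G s := X th s + d * X th 0 * s - d * Z s - 2 * d ^+ 2 * K * m th * (s * s).
suff : G 1 <= G 0.
  rewrite /G !mulr0 !mulr1 subr0 addr0 Z10 => h.
  rewrite (_ : _ * m th = (1 - d) * (M * m th) + 2 * d ^+ 2 * K * m th); last ring.
  apply: (@le_trans _ _ ((1 - d) * X th 0 + 2 * d ^+ 2 * K * m th)); first lra.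
  by rewrite lerD2r ler_wpM2l ?subr_ge0// (XM _ _ Tth).
apply: (@derive_le0_le _ G (fun s => d * (X (reflect_test (2 * s) th) s - X th s)
   + d * X th 0 - d * X (reflect_test (2 * s) th) 0 - 2 * d ^+ 2 * K * m th * (2 * s))); last exact: ler01.
- move=> s; apply: cvgB; last by apply: cvgMr; apply: cvgM; exact: cvg_id.
  apply: cvgB; last by apply: cvgMr; exact: (is_derive_continuous dZ).
  apply: cvgD; first exact: (rt_continuous rt Tth).
  by apply: cvgMr; exact: cvg_id.
- move=> s s0.
  have did := is_derive_id (s : R) (1 : R).
  have := is_deriveB (is_deriveB (is_deriveD (rt_derive rt Tth s0)
    (is_deriveZ (d * X th 0) did)) (is_deriveZ d (dZ s)))
    (is_deriveZ (2 * d ^+ 2 * K * m th) (is_deriveM did did)).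
  by move=> h; apply: (is_derive_eq h); rewrite /GRing.scale/=; ring.
- move=> s s0 _.
  have := up _ _ (unit_test_reflect (2 * s) Tth) s (ltW s0).
  have := lo _ _ Tth s (ltW s0).
  rewrite (rt_mass rt _ Tth) => h1 h2.
  rewrite (_ : _ - _ = d * ((X (reflect_test (2 * s) th) s
      - (X (reflect_test (2 * s) th) 0 + 2 * d * K * m th * s)) +
      (- X th s - (- X th 0 + 2 * d * K * m th * s)))); last ring.
  by apply: mulr_ge0_le0 => //; lra.
Qed.

End dynamics.

(** * Adjoint waves and boundary cutoffs *)

Section test_functions.
Variable R : realType.
Implicit Types (th f : R -> R).

Lemma is_derive_fst (phi : R * R -> R) (x t d : R) :
  is_derive x 1 (fun y : R => phi (y, t)) d -> is_derive (x, t) (1, 0) phi d.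
Proof.
have e : (fun h : R => h^-1 *: (phi (h *: ((1, 0) : R * R) + (x, t)) - phi (x, t))) =
    (fun h : R => h^-1 *: (phi (h *: (1 : R) + x, t) - phi (x, t))).
  apply/funext => h.
  rewrite (_ : h *: _ + _ = (h *: (1 : R) + x, h *: (0 : R) + t))//.
  by rewrite scaler0 add0r.
by move=> [df <-]; split; rewrite /derivable /derive e.
Qed.

Lemma is_derive_snd (phi : R * R -> R) (x t d : R) :
  is_derive t 1 (fun s : R => phi (x, s)) d -> is_derive (x, t) (0, 1) phi d.
Proof.
have e : (fun h : R => h^-1 *: (phi (h *: ((0, 1) : R * R) + (x, t)) - phi (x, t))) =
    (fun h : R => h^-1 *: (phi (x, h *: (1 : R) + t) - phi (x, t))).
  apply/funext => h.
  rewrite (_ : h *: _ + _ = (h *: (0 : R) + x, h *: (1 : R) + t))//.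
  by rewrite scaler0 add0r.
by move=> [df <-]; split; rewrite /derivable /derive e.
Qed.

(** A compact [C] inside [Q] that carries [phi] is closed, so it also contains the closure of the
    support, even where [Q] is not closed. *)
Lemma test_functionI (Q C : set (R * R)) (phi phi_x phi_t : R * R -> R) :
  continuous phi -> continuous phi_x -> continuous phi_t ->
  (forall x t : R, is_derive x 1 (fun y : R => phi (y, t)) (phi_x (x, t))) ->
  (forall x t : R, is_derive t 1 (fun s : R => phi (x, s)) (phi_t (x, t))) ->
  compact C -> C `<=` Q -> (forall p, Q p -> phi p != 0 -> C p) ->
  test_function Q phi phi_x phi_t.
Proof.
move=> c cx ct dx dt cC CQ supp; split.
  split; [exact: continuous_subspaceT..|].
  by move=> [x t] _; split; [exact: is_derive_fst|exact: is_derive_snd].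
have sub : closure (Q `&` [set p | phi p != 0]) `<=` C.
  have closedC : closed C by apply: compact_closed => //; exact: norm_hausdorff.
  rewrite ((closure_id C).1 closedC); apply: closure_subset => p [].
  exact: supp.
split; last exact: subset_trans sub CQ.
by apply: subclosed_compact cC sub; exact: closed_closure.
Qed.

(** These are the weights of [rho] and [J] when [f^+] is tested with [f (x - t)] and [f^-] with
    [f (- x - t)]. The pair solves the undamped adjoint system: the time derivative of each is minus
    the space derivative of the other. *)
Definition even_wave f (p : R * R) : R := (f (p.1 - p.2) + f (- p.1 - p.2)) / 2.
Definition odd_wave f (p : R * R) : R := (f (p.1 - p.2) - f (- p.1 - p.2)) / 2.

Lemma continuous_characteristics f : continuous f ->
  continuous (fun p : R * R => f (p.1 - p.2)) /\
  continuous (fun p : R * R => f (- p.1 - p.2)).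
Proof.
move=> cf.
have c1 : continuous (fun p : R * R => p.1 - p.2).
  by move=> p; apply: cvgB; [exact: cvg_fst|exact: cvg_snd].
have c2 : continuous (fun p : R * R => - p.1 - p.2).
  by move=> p; apply: cvgB; [apply: cvgN; exact: cvg_fst|exact: cvg_snd].
split=> p.
  by apply: (@continuous_comp _ _ _ (fun p : R * R => p.1 - p.2) f);
    [exact: c1|exact: cf].
by apply: (@continuous_comp _ _ _ (fun p : R * R => - p.1 - p.2) f);
  [exact: c2|exact: cf].
Qed.

Lemma continuous_even_wave f : continuous f -> continuous (even_wave f).
Proof.
move=> /continuous_characteristics[c1 c2] p; apply: cvgMl.
by apply: cvgD; [exact: c1|exact: c2].
Qed.

Lemma continuous_odd_wave f : continuous f -> continuous (odd_wave f).
Proof.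
move=> /continuous_characteristics[c1 c2] p; apply: cvgMl.
by apply: cvgB; [exact: c1|exact: c2].
Qed.

Lemma is_derive_ext (f g : R -> R) (x df dg : R) : is_derive x 1 f df ->
  f =1 g -> df = dg -> is_derive x 1 g dg.
Proof. by move=> h /funext <- <-. Qed.

Section wave_derivatives.
Variables f f' : R -> R.
Hypothesis df : forall y : R, is_derive y 1 f (f' y).

Let d1x (x t : R) : is_derive x 1 (fun y => f (y - t)) (f' (x - t)).
Proof. exact: is_derive_comp_sub. Qed.

Let d2x (x t : R) : is_derive x 1 (fun y => f (- y - t)) (- f' (- x - t)).
Proof. exact: is_derive_comp_refl. Qed.

Let d1t (x t : R) : is_derive t 1 (fun s => f (x - s)) (- f' (x - t)).
Proof.
have := is_derive_comp_refl (- x) df t.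
rewrite (_ : (fun y => _) = (fun s => f (x - s))).
  by rewrite opprK addrC.
by apply/funext => s; rewrite opprK addrC.
Qed.

Let d2t (x t : R) : is_derive t 1 (fun s => f (- x - s)) (- f' (- x - t)).
Proof. exact: d1t. Qed.

Lemma even_wave_derive_x (x t : R) :
  is_derive x 1 (fun y => even_wave f (y, t)) (odd_wave f' (x, t)).
Proof.
apply: (is_derive_ext (is_deriveZ (2^-1 : R) (is_deriveD (d1x x t) (d2x x t)))).
  by move=> y; exact: mulrC.
by rewrite -[_ *: _]/(_ * _) /even_wave /odd_wave/=; field.
Qed.

Lemma odd_wave_derive_x (x t : R) :
  is_derive x 1 (fun y => odd_wave f (y, t)) (even_wave f' (x, t)).
Proof.
apply: (is_derive_ext (is_deriveZ (2^-1 : R) (is_deriveB (d1x x t) (d2x x t)))).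
  by move=> y; exact: mulrC.
by rewrite -[_ *: _]/(_ * _) /even_wave /odd_wave/=; field.
Qed.

Lemma even_wave_derive_t (x t : R) :
  is_derive t 1 (fun s => even_wave f (x, s)) (- even_wave f' (x, t)).
Proof.
apply: (is_derive_ext (is_deriveZ (2^-1 : R) (is_deriveD (d1t x t) (d2t x t)))).
  by move=> y; exact: mulrC.
by rewrite -[_ *: _]/(_ * _) /even_wave /odd_wave/=; field.
Qed.

Lemma odd_wave_derive_t (x t : R) :
  is_derive t 1 (fun s => odd_wave f (x, s)) (- odd_wave f' (x, t)).
Proof.
apply: (is_derive_ext (is_deriveZ (2^-1 : R) (is_deriveB (d1t x t) (d2t x t)))).
  by move=> y; exact: mulrC.
by rewrite -[_ *: _]/(_ * _) /even_wave /odd_wave/=; field.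
Qed.

End wave_derivatives.

Lemma even_wave_bound f (L : R) p : (forall y, `|f y| <= L) -> `|even_wave f p| <= L.
Proof.
move=> fL; rewrite /even_wave normrM [`|2^-1|]ger0_norm ?invr_ge0// ler_pdivrMr//.
by rewrite (le_trans (ler_normD _ _))// mulr_natr mulr2n lerD.
Qed.

Lemma odd_wave_bound f (L : R) p : (forall y, `|f y| <= L) -> `|odd_wave f p| <= L.
Proof.
move=> fL; rewrite /odd_wave normrM [`|2^-1|]ger0_norm ?invr_ge0// ler_pdivrMr//.
by rewrite (le_trans (ler_normB _ _))// mulr_natr mulr2n lerD.
Qed.

Lemma lipschitz_of_derive f (f' : R -> R) (L : R) :
  (forall y : R, is_derive y 1 f (f' y)) -> (forall y, `|f' y| <= L) ->
  forall x y, `|f x - f y| <= L * `|x - y|.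
Proof.
move=> df f'L x y; wlog xy : x y / y <= x.
  by move=> w; have [/w//|/ltW/w] := leP y x; rewrite distrC (distrC y).
have [|z _ ->] := @MVT_segment _ f f' y x xy.
  exact/continuous_subspaceT/(is_derive_continuous df).
by rewrite normrM ler_wpM2r.
Qed.

(* The odd wave vanishes at [x = 0] by symmetry and at [x = 1] by periodicity. *)
Lemma odd_wave_boundary th th' : circle_test th th' ->
  exists2 L : R, 0 <= L &
  forall x t, I01 R x -> `|odd_wave th (x, t)| <= L * (x * (1 - x)).
Proof.
move=> T; have [L thL] := circle_lipschitz T.
have L0 : 0 <= L by apply: le_trans (thL 0).
have lip := lipschitz_of_derive (circle_derive T) thL.
exists (2 * L); first by rewrite mulr_ge0.
move=> x t; rewrite /I01/= in_itv/= => /andP[x0 x1].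
rewrite /odd_wave/= normrM [`|2^-1|]ger0_norm ?invr_ge0// ler_pdivrMr//.
have h0 := lip (x - t) (- x - t).
have h1 := lip (x - t) (- x - t + 2); rewrite (circle_periodic T) in h1.
rewrite (_ : _ - _ - _ = 2 * x) in h0; last ring.
rewrite [`|2 * x|]ger0_norm ?mulr_ge0// in h0.
rewrite (_ : x - t - (- x - t + 2) = - (2 * (1 - x))) in h1; last ring.
rewrite normrN [`|2 * _|]ger0_norm ?mulr_ge0 ?subr_ge0// in h1.
have [xh|hx] := leP x (1 / 2).
  apply: (le_trans h0); rewrite -!mulrA [2 * (L * _)]mulrCA ler_wpM2l//.
  by rewrite -subr_ge0; nra.
apply: (le_trans h1); rewrite -!mulrA [2 * (L * _)]mulrCA ler_wpM2l//.
by rewrite -subr_ge0; nra.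
Qed.

End test_functions.

(** * C^1 cutoffs that vanish near the endpoints of [I] *)

Section cutoff.
Variable R : realType.

Let v (e x : R) : R := pospart (x * (1 - x) - e).
Let den (e x : R) : R := v e x ^+ 2 + e ^+ 2.

(* [v^2 / (v^2 + e^2)] with [v = (x (1 - x) - e)^+] *)
Definition cutoff (e x : R) : R :=
  1 - e ^+ 2 / (pospart (x * (1 - x) - e) ^+ 2 + e ^+ 2).

Definition cutoff' (e x : R) : R :=
  e ^+ 2 * (2 * pospart (x * (1 - x) - e) * (1 - 2 * x)) /
  (pospart (x * (1 - x) - e) ^+ 2 + e ^+ 2) ^+ 2.

Let den_gt0 (e x : R) : 0 < e -> 0 < den e x.
Proof. by move=> e0; rewrite ltr_wpDl ?sqr_ge0// exprn_gt0. Qed.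

Lemma cutoff_ge0 (e x : R) : 0 < e -> 0 <= cutoff e x.
Proof.
move=> e0; rewrite /cutoff subr_ge0 ler_pdivrMr ?den_gt0// mul1r lerDr.
exact: sqr_ge0.
Qed.

Lemma cutoff_le1 (e x : R) : 0 < e -> cutoff e x <= 1.
Proof.
by move=> e0; rewrite /cutoff lerBlDr lerDl divr_ge0 ?sqr_ge0// ltW// den_gt0.
Qed.

Lemma cutoff_neq0 (e x : R) : 0 < e -> cutoff e x != 0 -> e <= x * (1 - x).
Proof.
move=> e0; apply: contraNT; rewrite -ltNge => xe.
rewrite /cutoff pospart_eq0; last by rewrite subr_le0 ltW.
by rewrite expr0n add0r divff ?subrr// gt_eqF// exprn_gt0.
Qed.

Let dv2 (e x : R) : is_derive x 1 (fun y => v e y ^+ 2) (2 * v e x * (1 - 2 * x)).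
Proof.
apply: (@is_derive1_comp _ (fun z => pospart z ^+ 2) (fun y => y * (1 - y) - e)).
  exact: is_derive_sqr_pospart.
have did := is_derive_id (x : R) (1 : R).
apply: (is_derive_ext (is_deriveB
  (is_deriveM did (is_deriveB (is_derive_cst (1 : R) (x : R) (1 : R)) did))
  (is_derive_cst (e : R) (x : R) (1 : R)))) => //.
rewrite !fctE -[_ *: (_ - _)]/(_ * _) -[_ *: 1]/(_ * _); ring.
Qed.

Lemma is_derive_cutoff (e : R) : 0 < e ->
  forall x : R, is_derive x 1 (cutoff e) (cutoff' e x).
Proof.
move=> e0 x.
have den0 : den e x != 0 by rewrite gt_eqF// den_gt0.
have dden : is_derive x 1 (den e) (2 * v e x * (1 - 2 * x)).
  apply: (is_derive_ext (is_deriveD (dv2 e x)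
    (is_derive_cst (e ^+ 2 : R) (x : R) (1 : R)))) => //.
  by rewrite addr0.
have dinv := @is_deriveV _ (den e) _ _ _ den0 dden.
apply: (is_derive_ext (is_deriveB (is_derive_cst (1 : R) (x : R) (1 : R))
  (is_deriveZ (e ^+ 2) dinv))) => //.
rewrite -[_ *: _]/(_ * _) -[_ *: _]/(_ * _) /cutoff' -/(v e x) -/(den e x).
by field.
Qed.

Lemma continuous_cutoff' (e : R) : 0 < e -> continuous (cutoff' e).
Proof.
move=> e0.
have cs : continuous (fun x : R => x * (1 - x) - e).
  move=> x; apply: cvgB; last exact: cvg_cst.
  by apply: cvgM; [exact: cvg_id|apply: cvgB; [exact: cvg_cst|exact: cvg_id]].
have cv : continuous (v e).
  move=> x; apply: (@continuous_comp _ _ _ (fun x : R => x * (1 - x) - e) (@pospart R)).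
    exact: cs.
  exact: continuous_pospart.
have cden : continuous (den e).
  move=> x; apply: cvgD; last exact: cvg_cst.
  exact: (is_derive_continuous (dv2 e)).
move=> x; apply: cvgM.
  apply: cvgMr; apply: cvgM; first by apply: cvgMr; exact: cv.
  by apply: cvgB; [exact: cvg_cst|apply: cvgMr; exact: cvg_id].
apply: cvgV; first by rewrite expf_neq0// gt_eqF// (den_gt0 x e0).
by have := cvgM (cden x) (cden x); exact.
Qed.

(** The cutoff climbs where [x * (1 - x)] is of order [e], with a slope of order [1 / e], so the
    product is bounded uniformly in [e]. *)
Lemma cutoff'_bound (e x : R) : 0 < e -> I01 R x ->
  x * (1 - x) * `|cutoff' e x| <= 2.
Proof.
move=> e0; rewrite /I01/= in_itv/= => /andP[x0 x1].
have [xe|ex] := leP (x * (1 - x) - e) 0.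
  by rewrite /cutoff' pospart_eq0// !(mulr0, mul0r) normr0 mulr0.
rewrite /cutoff' pospart_id; last exact: ltW.
set w := _ - e in ex *.
have -> : x * (1 - x) = w + e by rewrite /w subrK.
have d0 : 0 < w ^+ 2 + e ^+ 2 by rewrite addr_gt0// exprn_gt0.
have s1 : `|1 - 2 * x| <= 1 by rewrite ler_norml; apply/andP; split; lra.
rewrite normrM normfV [`|(_ + _) ^+ 2|]ger0_norm ?sqr_ge0//.
rewrite [(w + e) * (_ / _)]mulrA ler_pdivrMr ?exprn_gt0//.
have w2 : 0 <= 2 * w by rewrite mulr_ge0// ltW.
rewrite normrM (ger0_norm (sqr_ge0 e)) normrM (ger0_norm w2).
apply: (@le_trans _ _ ((w + e) * (e ^+ 2 * (2 * w * 1)))).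
  apply: ler_wpM2l; first by rewrite addr_ge0// ltW.
  apply: ler_wpM2l; first exact: sqr_ge0.
  by apply: ler_wpM2l => //; rewrite mulr_ge0// ltW.
have := sqr_ge0 (w - e); have := sqr_ge0 (w ^+ 2); have := sqr_ge0 (w * e) => h1 h2 h3.
have h4 : 0 <= e ^+ 2 * (w - e) ^+ 2 by rewrite mulr_ge0// sqr_ge0.
(* A certificate, as a sum of nonnegative terms, for [(w + e) * (e ^+ 2 * (2 * w)) <= 2 * (w ^+ 2 +
   e ^+ 2) ^+ 2]. *)
rewrite -subr_ge0 (_ : _ - _ = 2 * (w ^+ 2) ^+ 2 + (w * e) ^+ 2 + e ^+ 2 * (w - e) ^+ 2
  + (e ^+ 2) ^+ 2); last by ring.
have h5 : 0 <= 2 * (w ^+ 2) ^+ 2 by rewrite mulr_ge0// sqr_ge0.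
by apply: addr_ge0; [apply: addr_ge0; [exact: addr_ge0|]|exact: sqr_ge0].
Qed.

Let eps (n : nat) : R := n.+1%:R^-1.

Let eps_cvg0 : eps n @[n --> \oo] --> (0 : R).
Proof. exact: cvg_harmonic. Qed.

Section cutoff_limits.
Variable x : R.
Hypothesis x01 : 0 < x < 1.
Let s := x * (1 - x).

Let s_gt0 : 0 < s.
Proof. by case/andP: x01 => x0 x1; rewrite mulr_gt0// subr_gt0. Qed.

Let v_cvg : v (eps n) x @[n --> \oo] --> s.
Proof.
have h : s - eps n @[n --> \oo] --> s.
  by rewrite -[X in _ --> X]subr0; apply: cvgB; [exact: cvg_cst|exact: eps_cvg0].
have := @cvg_comp _ _ _ _ (@pospart R) _ _ _ h (@continuous_pospart R s).
by rewrite pospart_id// ltW.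
Qed.

Let eps2_cvg : eps n ^+ 2 @[n --> \oo] --> (0 : R).
Proof. by have := cvgM eps_cvg0 eps_cvg0; rewrite mulr0; exact. Qed.

Let invden_cvg : (den (eps n) x)^-1 @[n --> \oo] --> (s ^+ 2)^-1.
Proof.
apply: cvgV; first by rewrite expf_neq0// gt_eqF.
rewrite -[X in _ --> X]addr0; apply: cvgD; last exact: eps2_cvg.
by have := cvgM v_cvg v_cvg; exact.
Qed.

Lemma cutoff_cvg : cutoff n.+1%:R^-1 x @[n --> \oo] --> (1 : R).
Proof.
rewrite -[X in _ --> X]subr0; apply: cvgB; first exact: cvg_cst.
by have := cvgM eps2_cvg invden_cvg; rewrite mul0r; exact.
Qed.

Lemma cutoff'_cvg : cutoff' n.+1%:R^-1 x @[n --> \oo] --> (0 : R).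
Proof.
have h1 : 2 * v (eps n) x * (1 - 2 * x) @[n --> \oo] --> 2 * s * (1 - 2 * x).
  by apply: cvgMl; apply: cvgMr; exact: v_cvg.
have h2 := cvgM (cvgM eps2_cvg h1) (cvgM invden_cvg invden_cvg).
rewrite !mul0r in h2; rewrite (_ : (fun n => _) = (fun n => eps n ^+ 2 *
  (2 * v (eps n) x * (1 - 2 * x)) * ((den (eps n) x)^-1 * (den (eps n) x)^-1))); first exact: h2.
  by apply/funext => n; rewrite /cutoff' -invfM.
Qed.

End cutoff_limits.

End cutoff.

(** * From the weak formulation to an evolution equation *)

Section time_integrals.
Variable R : realType.
Local Notation mu := (@lebesgue_measure R).

(** Since [pospart] is continuous with values in [[0, +oo[], it turns the one-sided continuity at
    time [0] into continuity on the whole line. *)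
Lemma continuous_to_L1_pospart (u : R -> R -> R) : continuous_to_L1_I u ->
  forall s, L1dist_I (u (pospart t)) (u (pospart s)) @[t --> s] --> 0%E.
Proof.
move=> cu s A /(cu _ (pospart_ge0 s)) wA.
have h := continuous_pospart wA; rewrite /= in h.
have : \forall t \near s, L1dist_I (u (pospart t)) (u (pospart s)) \in A.
  near=> t; rewrite inE.
  have : (`[0, +oo[%classic (pospart t) -> A (L1dist_I (u (pospart t)) (u (pospart s)))).
    by near: t; exact: h.
  by apply; rewrite /= in_itv/= pospart_ge0.
by apply: filterS => t; rewrite inE.
Unshelve. all: by end_near.
Qed.

(** By the reverse triangle inequality, the absolute values of the slices again form an
    [L^1]-continuous curve. These norms later dominate integrands in time. *)
Lemma L1_norm_continuous (u : R -> R -> R) :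
  (forall t, mu.-integrable (I01 R) (EFin \o u t)) ->
  (forall s, L1dist_I (u t) (u s) @[t --> s] --> 0%E) ->
  continuous (fun t => \int[mu]_(x in I01 R) `|u t x|).
Proof.
move=> iu cu.
have inu t : mu.-integrable (I01 R) (EFin \o (fun x => `|u t x|)).
  exact: integrable_norm.
have cnu s : L1dist_I (fun x => `|u t x|) (fun x => `|u s x|) @[t --> s] --> 0%E.
  apply: (squeeze_cvge _ (@cvg_cst _ 0%E _ _ _) (cu s)).
  apply: nearW => t; apply/andP; split.
    by apply: integral_ge0 => x _; rewrite lee_fin.
  apply: ge0_le_integral => //.
  - exact: measurable_I01.
  - apply/measurable_EFinP; apply: measurableT_comp => //.
    exact: (integrable_measurable_fun (integrableB_I (inu t) (inu s))).
  - apply/measurable_EFinP; apply: measurableT_comp => //.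
    exact: (integrable_measurable_fun (integrableB_I (iu t) (iu s))).
  - by move=> x _; rewrite lee_fin ler_dist_dist.
have := pairing_continuous inu cnu (@cst_continuous _ _ (1 : R)).
rewrite (_ : (fun t => _) = (fun t => \int[mu]_(x in I01 R) `|u t x|))//.
by apply/funext => t; apply: eq_Rintegral => x _; rewrite mulr1.
Qed.

Definition pairing (u b : R -> R) : R := \int[mu]_(x in I01 R) (u x * b x).

Lemma pairing_bound (u b : R -> R) (C : R) : mu.-integrable (I01 R) (EFin \o u) ->
  continuous b -> (forall x, I01 R x -> `|b x| <= C) ->
  `|pairing u b| <= C * \int[mu]_(x in I01 R) `|u x|.
Proof.
move=> iu cb bC; have mI := @measurable_I01 R.
have iub := integrableM_continuous iu cb.
rewrite /pairing (le_trans (le_normr_Rintegral mI iub))// -RintegralZl//; last first.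
  exact: integrable_norm.
apply: le_Rintegral => //.
- exact: integrable_norm.
- exact/integrableZ_I/integrable_norm.
- by move=> x Ix; rewrite normrM mulrC ler_wpM2r// bC.
Qed.

Lemma pairingD (u b c : R -> R) : mu.-integrable (I01 R) (EFin \o u) ->
  continuous b -> continuous c ->
  pairing u (fun x => b x + c x) = pairing u b + pairing u c.
Proof.
move=> iu cb cc; rewrite /pairing -RintegralD; last 3 first.
- exact: measurable_I01.
- exact: integrableM_continuous.
- exact: integrableM_continuous.
by apply: eq_Rintegral => x _; rewrite mulrDr.
Qed.

Lemma pairingZ (u b : R -> R) (k : R) : mu.-integrable (I01 R) (EFin \o u) ->
  continuous b -> pairing u (fun x => k * b x) = k * pairing u b.
Proof.
move=> iu cb; rewrite /pairing -RintegralZl; last 2 first.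
- exact: measurable_I01.
- exact: integrableM_continuous.
by apply: eq_Rintegral => x _; rewrite mulrCA.
Qed.

Lemma Rintegral_time_support (a b : R) (G : R -> R) : 0 < a ->
  (forall t, t <= a \/ b <= t -> G t = 0) ->
  \int[mu]_(t in `]0, +oo[) G t = \int[mu]_(t in `[a, b]) G t.
Proof.
move=> a0 G0.
have -> : `[a, b]%classic = (`]0, +oo[ `&` `[a, b])%classic :> set R.
  apply/seteqP; split => [t abt|t []//]; split => //.
  by move: abt; rewrite /= !in_itv/= andbT => /andP[/(lt_le_trans a0)].
rewrite Rintegral_mkcondr; apply: eq_Rintegral => t _.
rewrite patchE; case: ifPn => //; rewrite notin_setE/= in_itv/= => /negP.
rewrite negb_and -!ltNge => tab; apply: G0.
by case/orP: tab => /ltW; [left|right].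
Qed.

Lemma Rintegral_I01_oo (f : R -> R) : mu.-integrable (I01 R) (EFin \o f) ->
  \int[mu]_(x in I01 R) f x = \int[mu]_(x in `]0, 1[) f x.
Proof.
move=> i; rewrite Rintegral_itv_bndo_bndc; last first.
  apply: integrableS i => //; first exact: measurable_I01.
  by move=> x; rewrite /I01/= !in_itv/= => /andP[/ltW -> /ltW ->].
rewrite Rintegral_itv_obnd_cbnd//.
apply: integrableS i => //; first exact: measurable_I01.
by move=> x; rewrite /I01/= !in_itv/= => /andP[/ltW -> ->].
Qed.

(** Convergence is asked for only inside []0, 1[], because every cutoff is [0] at the endpoints; the
    integrals are first moved to the open interval. *)
Lemma pairing_dominated_cvg (u b G : R -> R) (b_ : nat -> R -> R) :
  mu.-integrable (I01 R) (EFin \o u) ->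
  (forall n, continuous (b_ n)) -> continuous b ->
  (forall x, 0 < x < 1 -> b_ n x @[n --> \oo] --> b x) -> continuous G ->
  (forall n x, I01 R x -> `|b_ n x| <= G x) ->
  pairing u (b_ n) @[n --> \oo] --> pairing u b.
Proof.
move=> iu cb_ cb b_b cG b_G.
rewrite /pairing (Rintegral_I01_oo (integrableM_continuous iu cb)).
under eq_fun do rewrite (Rintegral_I01_oo (integrableM_continuous iu (cb_ _))).
have oo_cc : `]0, 1[%classic `<=` I01 R.
  by move=> x; rewrite /I01/= !in_itv/= => /andP[/ltW -> /ltW ->].
have ioo (f : R -> R) : mu.-integrable (I01 R) (EFin \o f) ->
    mu.-integrable `]0, 1[ (EFin \o f).
  by apply: integrableS => //; exact: measurable_I01.
apply: (@Rintegral_dominated_cvg R _ _ mu `]0, 1[%classic _ _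
    (fun x => `|u x| * G x)) => //.
- move=> n; apply: integrable_measurable_fun; apply: ioo.
  exact: integrableM_continuous.
- move=> x; rewrite /= in_itv/= => x01.
  by apply: cvgMr; exact: b_b.
- by apply/ioo/integrableM_continuous => //; exact: integrable_norm.
- by move=> n x /oo_cc Ix; rewrite normrM ler_wpM2l// b_G.
Qed.

Lemma continuous_cutoff (e : R) : 0 < e -> continuous (@cutoff R e).
Proof. by move=> e0; exact/is_derive_continuous/is_derive_cutoff. Qed.

Lemma pairing_cutoff_cvg (u b : R -> R) : mu.-integrable (I01 R) (EFin \o u) ->
  continuous b ->
  pairing u (fun x => b x * cutoff n.+1%:R^-1 x) @[n --> \oo] --> pairing u b.
Proof.
move=> iu cb.
have n0 n : 0 < n.+1%:R^-1 :> R by rewrite invr_gt0.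
apply: (@pairing_dominated_cvg u b (fun x => `|b x|)) => //.
- by move=> n x; apply: cvgM; [exact: cb|exact: continuous_cutoff].
- by move=> x x01; rewrite -[X in _ --> X]mulr1; apply: cvgMr; exact: cutoff_cvg.
- by move=> x; apply: cvg_norm; exact: cb.
- move=> n x _; rewrite normrM -[leRHS]mulr1 ler_wpM2l//.
  by rewrite ger0_norm ?cutoff_ge0// cutoff_le1.
Qed.

(** This disposes of the boundary term: the weight compensates the blow-up of [cutoff'], leaving the
    dominating constant [L * 2], while [cutoff'] tends to [0] at each interior point. *)
Lemma pairing_cutoff'_cvg (u b : R -> R) (L : R) : mu.-integrable (I01 R) (EFin \o u) ->
  continuous b -> (forall x, I01 R x -> `|b x| <= L * (x * (1 - x))) -> 0 <= L ->
  pairing u (fun x => b x * cutoff' n.+1%:R^-1 x) @[n --> \oo] --> (0 : R).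
Proof.
move=> iu cb bL L0.
have n0 n : 0 < n.+1%:R^-1 :> R by rewrite invr_gt0.
have -> : (0 : R) = pairing u (fun=> 0).
  by rewrite /pairing; under eq_Rintegral do rewrite mulr0; rewrite Rintegral_cst ?mul0r//;
    exact: measurable_I01.
apply: (@pairing_dominated_cvg u _ (fun=> L * 2)) => //.
- by move=> n x; apply: cvgM; [exact: cb|exact: continuous_cutoff'].
- exact: cst_continuous.
- by move=> x x01; rewrite -[X in _ --> X](mulr0 (b x)); apply: cvgMr; exact: cutoff'_cvg.
- exact: cst_continuous.
- move=> n x Ix; rewrite normrM.
  apply: (@le_trans _ _ (L * (x * (1 - x)) * `|cutoff' n.+1%:R^-1 x|)).
    by rewrite ler_wpM2r// bL.
  by rewrite -mulrA ler_wpM2l// cutoff'_bound.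
Qed.

End time_integrals.

(** * Membership in [L^oo(I)] as an almost-everywhere bound on [I] *)

Section essential_bounds.
Variable R : realType.
Local Notation mu := (@lebesgue_measure R).

Lemma ae_lebIP (P : R -> Prop) :
  (\forall x \ae lebI R, P x) <-> {ae mu, forall x, I01 R x -> P x}.
Proof.
have mI := @measurable_I01 R; split=> [[N [mN N0 PN]]|[N [mN N0 PN]]].
  exists (N `&` I01 R); split; [exact: measurableI|exact: N0|].
  move=> x /= /not_implyP[Ix nP]; split => //; exact: PN.
exists (N `|` ~` I01 R); split.
- by apply: measurableU => //; exact: measurableC.
- have -> : lebI R (N `|` ~` I01 R) = mu (N `&` I01 R).
    by rewrite /lebI/= /mrestr setIUl setICl setU0.
  apply/eqP; rewrite -measure_le0 -[leRHS]N0; apply: le_measure; rewrite ?inE//.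
  exact: measurableI.
- move=> x /= nP; have [Ix|nIx] := pselect (I01 R x); [left|by right].
  by apply: PN => /= h; exact/nP/h.
Qed.

Lemma lebI_setT_gt0 : (0 < lebI R [set: R])%E.
Proof.
rewrite /lebI/= /mrestr setTI lebesgue_measure_itv/= lte_fin ltr01.
by rewrite oppr0 adde0 lte_fin ltr01.
Qed.

Lemma Linfty_ae_bound (f : R -> R) : in_Linfty_I f ->
  exists2 B : R, 0 <= B & {ae mu, forall x, I01 R x -> `|f x| <= B}.
Proof.
(* The norm with exponent [+oo] is defined by cases on whether the total mass is positive. *)
move=> [_]; rewrite unlock /= lebI_setT_gt0 => /ess_supr_bounded[B hB].
exists (Num.max B 0); first by rewrite le_max lexx orbT.
apply/ae_lebIP; apply: filterS hB => x /= h.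
by rewrite le_max h.
Qed.

Lemma Linfty_integrable (f : R -> R) : in_Linfty_I f ->
  mu.-integrable (I01 R) (EFin \o f).
Proof.
move=> fL; have [B B0 fB] := Linfty_ae_bound fL; have mI := @measurable_I01 R.
have mf : measurable_fun (I01 R) f by case: fL.
apply/integrableP; split; first exact/measurable_EFinP.
apply: (@le_lt_trans _ _ (\int[mu]_(x in I01 R) (cst B%:E) x)%E).
  apply: ae_ge0_le_integral => //.
  - by apply/measurable_EFinP; apply: measurableT_comp.
rewrite integral_cst// [X in (_ * X)%E](_ : _ = 1%E) ?mule1 ?ltry//.
by rewrite [LHS]lebesgue_measure_itv/= lte_fin ltr01 oppr0 adde0.
Qed.

End essential_bounds.

(** * The weak formulation tested with waves *)

Section weak_to_ode.
Variable R : realType.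
Local Notation mu := (@lebesgue_measure R).

Lemma continuous_slice (a : R * R -> R) (t : R) : continuous a ->
  continuous (fun x => a (x, t)).
Proof.
move=> ca x; apply: (@continuous_comp _ _ _ (fun x => (x, t)) a); last exact: ca.
by apply: continuous_pair => y; [exact: cvg_id|exact: cvg_cst].
Qed.

Arguments continuous_slice [a] t.

Lemma pairing_lin2 (u b c : R -> R) (k1 k2 : R) : mu.-integrable (I01 R) (EFin \o u) ->
  continuous b -> continuous c ->
  pairing u (fun x => k1 * b x + k2 * c x) = k1 * pairing u b + k2 * pairing u c.
Proof.
by move=> iu cb cc; rewrite pairingD ?pairingZ// => x; apply: cvgMr; [exact: cb|exact: cc].
Qed.

Lemma Rintegral_pairingD (u w b c : R -> R) :
  mu.-integrable (I01 R) (EFin \o u) -> mu.-integrable (I01 R) (EFin \o w) ->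
  continuous b -> continuous c ->
  \int[mu]_(x in I01 R) (u x * b x + w x * c x) = pairing u b + pairing w c.
Proof.
move=> iu iw cb cc; rewrite RintegralD//; first exact: measurable_I01.
  exact: integrableM_continuous.
exact: integrableM_continuous.
Qed.

Lemma Rintegral_I01_eq0 (f : R -> R) : (forall x, f x = 0) ->
  \int[mu]_(x in I01 R) f x = 0.
Proof.
move=> f0; rewrite (@eq_Rintegral _ _ _ mu _ (fun=> 0)); last by move=> x _; exact: f0.
by rewrite Rintegral_cst ?mul0r//; exact: measurable_I01.
Qed.

Lemma continuous_fst_comp (f : R -> R) : continuous f ->
  continuous (fun p : R * R => f p.1).
Proof.
move=> cf p; apply: (@continuous_comp _ _ _ fst f); last exact: cf.
exact: cvg_fst.
Qed.

Lemma continuous_snd_comp (f : R -> R) : continuous f ->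
  continuous (fun p : R * R => f p.2).
Proof.
move=> cf p; apply: (@continuous_comp _ _ _ snd f); last exact: cf.
exact: cvg_snd.
Qed.

Lemma continuous_mul (T : topologicalType) (f g : T -> R) :
  continuous f -> continuous g -> continuous (fun x => f x * g x).
Proof. by move=> cf cg x; apply: cvgM; [exact: cf|exact: cg]. Qed.

Lemma continuous_add (T : topologicalType) (f g : T -> R) :
  continuous f -> continuous g -> continuous (fun x => f x + g x).
Proof. by move=> cf cg x; apply: cvgD; [exact: cf|exact: cg]. Qed.

Lemma is_derive_mul (f g : R -> R) (x df dg : R) :
  is_derive x 1 f df -> is_derive x 1 g dg ->
  is_derive x 1 (fun y => f y * g y) (df * g x + f x * dg).
Proof.
move=> hf hg; apply: (is_derive_ext (is_deriveM hf hg)) => //.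
by rewrite -![_ *: _]/(_ * _); ring.
Qed.

Record time_test (a b : R) (chi chi' : R -> R) : Prop := TimeTest {
  tt_gt0 : 0 < a ;
  tt_lt : a < b ;
  tt_continuous : continuous chi' ;
  tt_derive : forall t : R, is_derive t 1 chi (chi' t) ;
  tt_support : forall t : R, t <= a \/ b <= t -> chi t = 0 /\ chi' t = 0 }.

Lemma tt_neq0 a b chi chi' (t : R) : time_test a b chi chi' ->
  chi t != 0 -> a <= t <= b.
Proof.
move=> T; apply: contraNT; rewrite negb_and -!ltNge => tab.
have /(tt_support T)[-> _] : t <= a \/ b <= t; last by rewrite eqxx.
by case/orP: tab => /ltW; [left|right].
Qed.

Variables (d : R) (rho0 J0 : R -> R) (rho J : R -> R -> R).
Hypothesis weak : weak_solution d rho0 J0 rho J.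

(* Extending the solution by its initial value makes functions of time
   continuous on the whole line. *)
Definition time_slice (u : R -> R -> R) (t x : R) : R := u x (pospart t).

Let r := time_slice rho.
Let j := time_slice J.

Lemma integrable_time_slice t :
  mu.-integrable (I01 R) (EFin \o r t) /\ mu.-integrable (I01 R) (EFin \o j t).
Proof.
by have [hr hj] := weak_Linfty weak (pospart_ge0 t); split; exact: Linfty_integrable.
Qed.

Let ir t := (integrable_time_slice t).1.
Let ij t := (integrable_time_slice t).2.

Lemma time_slice_L1 :
  (forall s, L1dist_I (r t) (r s) @[t --> s] --> 0%E) /\
  (forall s, L1dist_I (j t) (j s) @[t --> s] --> 0%E).
Proof.
by have [cr cj] := weak_continuous weak; split=> s;
  [exact: (continuous_to_L1_pospart cr)|exact: (continuous_to_L1_pospart cj)].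
Qed.

Let cr := time_slice_L1.1.
Let cj := time_slice_L1.2.

(** The test function is [chi t * even_wave th (x, t)], admissible without a cutoff because mass
    tests may be nonzero at [x = 0] and [x = 1]. This is where the boundary condition enters. *)
Lemma weak_mass_waves th th' a b chi chi' :
  unit_test th th' -> time_test a b chi chi' ->
  \int[mu]_(t in `[a, b])
    (chi' t * pairing (r t) (fun x => even_wave th (x, t)) +
     chi t * (pairing (j t) (fun x => odd_wave th' (x, t))
              - pairing (r t) (fun x => even_wave th' (x, t)))) = 0.
Proof.
move=> [Tth th01] Tchi.
have cth := circle_continuous Tth; have cth' := circle_continuous_derive Tth.
have dth := circle_derive Tth.
have cchi := is_derive_continuous (tt_derive Tchi).
have cchi' := tt_continuous Tchi.
have cP := continuous_even_wave cth.
have cP' := continuous_even_wave cth'.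
have cQ' := continuous_odd_wave cth'.
pose phi p := chi p.2 * even_wave th p.
pose phi_x p := chi p.2 * odd_wave th' p.
pose phi_t p := chi' p.2 * even_wave th p + - chi p.2 * even_wave th' p.
have cchi2 := continuous_snd_comp cchi.
have cchi'2 := continuous_snd_comp cchi'.
have cNchi2 : continuous (fun p : R * R => - chi p.2).
  by move=> p; apply: cvgN; exact: cchi2.
have cphi_x : continuous phi_x := continuous_mul cchi2 cQ'.
have cphi_t : continuous phi_t :=
  continuous_add (continuous_mul cchi'2 cP) (continuous_mul cNchi2 cP').
have test : test_function (`[0, 1] `*` `]0, +oo[) phi phi_x phi_t.
  apply: (@test_functionI _ _ (`[0, 1]%classic `*` `[a, b]%classic)).
  - exact: (continuous_mul cchi2 cP).
  - exact: cphi_x.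
  - exact: cphi_t.
  - move=> x t; have := is_derive_mul (is_derive_cst (chi t) (x : R) (1 : R))
      (even_wave_derive_x dth x t).
    by rewrite mul0r add0r.
  - move=> x t; apply: (is_derive_ext
      (is_derive_mul (tt_derive Tchi t) (even_wave_derive_t dth x t))) => //.
    by rewrite /phi_t/= mulrN mulNr.
  - by apply: compact_setX; exact: segment_compact.
  - move=> [x t] [Ix]; rewrite /= in_itv/= => /andP[at_ _]; split; first exact: Ix.
    by rewrite /= in_itv/= andbT (lt_le_trans (tt_gt0 Tchi)).
  - move=> [x t] [Ix _]; rewrite /phi mulf_eq0 negb_or => /andP[chit _].
    split; first exact: Ix.
    by rewrite /= in_itv/=; exact: (tt_neq0 Tchi chit).
have := weak_mass weak test.
rewrite (Rintegral_time_support (tt_gt0 Tchi) (b := b)); last first.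
  move=> t /(tt_support Tchi)[chi0 chi'0]; apply: Rintegral_I01_eq0 => x.
  by rewrite /phi_t /phi_x/= chi0 chi'0 oppr0 !mul0r addr0 !mulr0 addr0.
move=> <-; apply: eq_Rintegral => t; rewrite inE/= in_itv/= => /andP[at_ _].
have t0 : 0 <= t by rewrite ltW// (lt_le_trans (tt_gt0 Tchi)).
have rE : rho^~ t = r t by apply/funext => x; rewrite /r /time_slice pospart_id.
have jE : J^~ t = j t by apply/funext => x; rewrite /j /time_slice pospart_id.
transitivity (pairing (r t) (fun x => phi_t (x, t)) + pairing (j t) (fun x => phi_x (x, t))).
  rewrite /phi_t /phi_x /= pairing_lin2//; [|exact: continuous_slice..].
  rewrite pairingZ//; last exact: continuous_slice.
  ring.
rewrite -Rintegral_pairingD//.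
- by apply: eq_Rintegral => x _; rewrite -rE -jE.
- exact: continuous_slice.
- exact: continuous_slice.
Qed.

(** Momentum tests must be supported away from [x = 0] and [x = 1], so the odd wave is multiplied by
    [cutoff e]; the product rule creates the pairing with [cutoff']. *)
Lemma weak_momentum_cutoff th th' a b chi chi' (e : R) :
  unit_test th th' -> time_test a b chi chi' -> 0 < e ->
  \int[mu]_(t in `[a, b])
    (chi' t * pairing (j t) (fun x => odd_wave th (x, t) * cutoff e x) +
     chi t * (pairing (r t) (fun x => even_wave th' (x, t) * cutoff e x)
              + pairing (r t) (fun x => odd_wave th (x, t) * cutoff' e x)
              - pairing (j t) (fun x => odd_wave th' (x, t) * cutoff e x)
              - 2 * d * pairing (j t) (fun x => odd_wave th (x, t) * cutoff e x))) = 0.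
Proof.
move=> [Tth th01] Tchi e0.
have cth := circle_continuous Tth; have cth' := circle_continuous_derive Tth.
have dth := circle_derive Tth.
have cchi := is_derive_continuous (tt_derive Tchi).
have ccut := continuous_fst_comp (continuous_cutoff e0).
have ccut' := continuous_fst_comp (continuous_cutoff' e0).
have cQ := continuous_mul (continuous_odd_wave cth) ccut.
have cQ' := continuous_mul (continuous_odd_wave cth') ccut.
have cP' := continuous_mul (continuous_even_wave cth') ccut.
have cQc := continuous_mul (continuous_odd_wave cth) ccut'.
have cchi2 := continuous_snd_comp cchi.
have cchi'2 := continuous_snd_comp (tt_continuous Tchi).
have cNchi2 : continuous (fun p : R * R => - chi p.2).
  by move=> p; apply: cvgN; exact: cchi2.
pose psi p := chi p.2 * (odd_wave th p * cutoff e p.1).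
pose psi_x p := chi p.2 *
  (even_wave th' p * cutoff e p.1 + odd_wave th p * cutoff' e p.1).
pose psi_t p := chi' p.2 * (odd_wave th p * cutoff e p.1) +
  - chi p.2 * (odd_wave th' p * cutoff e p.1).
have cpsi : continuous psi := continuous_mul cchi2 cQ.
have cpsi_x : continuous psi_x := continuous_mul cchi2 (continuous_add cP' cQc).
have cpsi_t : continuous psi_t :=
  continuous_add (continuous_mul cchi'2 cQ) (continuous_mul cNchi2 cQ').
have test : test_function (`]0, 1[ `*` `]0, +oo[) psi psi_x psi_t.
  apply: (@test_functionI _ _ (`[e, 1 - e]%classic `*` `[a, b]%classic)).
  - exact: cpsi.
  - exact: cpsi_x.
  - exact: cpsi_t.
  - move=> x t; apply: (is_derive_ext (is_derive_mul
      (is_derive_cst (chi t) (x : R) (1 : R))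
      (is_derive_mul (odd_wave_derive_x dth x t) (is_derive_cutoff e0 x)))) => //.
    by rewrite mul0r add0r.
  - move=> x t; apply: (is_derive_ext (is_derive_mul (tt_derive Tchi t)
      (is_derive_mul (odd_wave_derive_t dth x t)
        (is_derive_cst (cutoff e x) (t : R) (1 : R))))) => //.
    by rewrite /psi_t/= mulr0 addr0 mulNr mulrN mulNr.
  - by apply: compact_setX; exact: segment_compact.
  - move=> [x t] [+ +]; rewrite /= !in_itv/= => /andP[ex xe] /andP[at_ _].
    split; rewrite ?andbT.
      by rewrite (lt_le_trans e0)//= (le_lt_trans xe)// ltrBlDr ltrDl.
    exact: (lt_le_trans (tt_gt0 Tchi)).
  - move=> [x t] [+ +]; rewrite /= !in_itv/= => /andP[x0 x1] _.
    rewrite /psi !mulf_eq0 !negb_or => /and3P[chit _ /(cutoff_neq0 e0) ex].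
    split; last by exact: (tt_neq0 Tchi chit).
    (* For [0 < x < 1], the bound [e <= x * (1 - x)] forces both [x] and [1 - x] to be at least
       [e]. *)
    rewrite /= in ex; apply/andP; split; nra.
have := weak_momentum weak test.
rewrite (Rintegral_time_support (tt_gt0 Tchi) (b := b)); last first.
  move=> t /(tt_support Tchi)[chi0 chi'0]; apply: Rintegral_I01_eq0 => x.
  by rewrite /psi_t /psi_x /psi/= chi0 chi'0 oppr0 !mul0r addr0 !mulr0 addr0 subr0.
move=> <-; apply: eq_Rintegral => t; rewrite inE/= in_itv/= => /andP[at_ _].
have t0 : 0 <= t by rewrite ltW// (lt_le_trans (tt_gt0 Tchi)).
have rE : rho^~ t = r t by apply/funext => x; rewrite /r /time_slice pospart_id.
have jE : J^~ t = j t by apply/funext => x; rewrite /j /time_slice pospart_id.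
transitivity (pairing (j t) (fun x => 1 * psi_t (x, t) + - (2 * d) * psi (x, t)) +
    pairing (r t) (fun x => psi_x (x, t))).
  rewrite pairing_lin2//; [|exact: continuous_slice..].
  rewrite /psi_t /psi_x /psi /= pairing_lin2//;
    [|exact: (continuous_slice t cQ)|exact: (continuous_slice t cQ')].
  rewrite pairingZ//; last exact: (continuous_slice t cQ).
  rewrite pairingZ//; last exact: (continuous_slice t (continuous_add cP' cQc)).
  rewrite pairingD//; [|exact: (continuous_slice t cP')|exact: (continuous_slice t cQc)].
  by ring.
rewrite -Rintegral_pairingD//.
- by apply: eq_Rintegral => x _; rewrite -rE -jE; ring.
- apply: continuous_add; apply: continuous_mul; try exact: cst_continuous;
    exact: continuous_slice.
- exact: continuous_slice.
Qed.

Lemma continuous_pairing_rho (f : R * R -> R) : continuous f ->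
  continuous (fun t => pairing (r t) (fun x => f (x, t))).
Proof. exact: pairing_continuous. Qed.

Lemma continuous_pairing_J (f : R * R -> R) : continuous f ->
  continuous (fun t => pairing (j t) (fun x => f (x, t))).
Proof. exact: pairing_continuous. Qed.

(** The cutoff parameter tends to [0]. Dominated convergence is used twice: in [x] for each pairing,
    the one with [cutoff'] disappearing, and then in [t], under a bound built from the [L^1] norms
    of the slices. *)
Lemma weak_momentum_waves th th' a b chi chi' :
  unit_test th th' -> time_test a b chi chi' ->
  \int[mu]_(t in `[a, b])
    (chi' t * pairing (j t) (fun x => odd_wave th (x, t)) +
     chi t * (pairing (r t) (fun x => even_wave th' (x, t))
              - pairing (j t) (fun x => odd_wave th' (x, t))
              - 2 * d * pairing (j t) (fun x => odd_wave th (x, t)))) = 0.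
Proof.
move=> UT Tchi; have [Tth th01] := UT.
have cth := circle_continuous Tth; have cth' := circle_continuous_derive Tth.
have cchi := is_derive_continuous (tt_derive Tchi).
have cchi' := tt_continuous Tchi.
have n0 n : 0 < n.+1%:R^-1 :> R by rewrite invr_gt0.
have [L thL] := circle_lipschitz Tth.
have L0 : 0 <= L by apply: le_trans (thL 0).
have [L1 L10 bdry] := odd_wave_boundary Tth.
have th1 y : `|th y| <= 1 by have /andP[y0 y1] := th01 y; rewrite ger0_norm.
have cQ := continuous_odd_wave cth.
have cQ' := continuous_odd_wave cth'.
have cP' := continuous_even_wave cth'.
pose nr t := \int[mu]_(x in I01 R) `|r t x|.
pose nj t := \int[mu]_(x in I01 R) `|j t x|.
have cnr : continuous nr by exact: L1_norm_continuous.
have cnj : continuous nj by exact: L1_norm_continuous.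
have nr0 t : 0 <= nr t by exact: Rintegral_ge0.
have nj0 t : 0 <= nj t by exact: Rintegral_ge0.
pose F n t := chi' t * pairing (j t) (fun x => odd_wave th (x, t) * cutoff n.+1%:R^-1 x) +
  chi t * (pairing (r t) (fun x => even_wave th' (x, t) * cutoff n.+1%:R^-1 x)
           + pairing (r t) (fun x => odd_wave th (x, t) * cutoff' n.+1%:R^-1 x)
           - pairing (j t) (fun x => odd_wave th' (x, t) * cutoff n.+1%:R^-1 x)
           - 2 * d * pairing (j t) (fun x => odd_wave th (x, t) * cutoff n.+1%:R^-1 x)).
set F0 := (X in Rintegral _ _ X).
pose G t := `|chi' t| * nj t +
  `|chi t| * ((L + 2 * L1) * nr t + (L + `|2 * d|) * nj t).
have cut_le (f : R * R -> R) C n t x : (forall p, `|f p| <= C) ->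
    `|f (x, t) * cutoff n.+1%:R^-1 x| <= C.
  move=> fC; rewrite normrM -[leRHS]mulr1 ler_pM//.
  by rewrite ger0_norm ?cutoff_ge0// cutoff_le1.
have ccut n := continuous_fst_comp (continuous_cutoff (n0 n)).
have ccut' n := continuous_fst_comp (continuous_cutoff' (n0 n)).
have cQn n := continuous_mul cQ (ccut n).
have cQ'n n := continuous_mul cQ' (ccut n).
have cP'n n := continuous_mul cP' (ccut n).
have cQcn n := continuous_mul cQ (ccut' n).
have cF n : continuous (F n).
  apply: continuous_add; apply: continuous_mul => //.
    exact: (continuous_pairing_J (cQn n)).
  move=> t; apply: cvgB; last by apply: cvgMr; exact: (continuous_pairing_J (cQn n)).
  apply: cvgB; last exact: (continuous_pairing_J (cQ'n n)).
  by apply: cvgD; [exact: (continuous_pairing_rho (cP'n n))|exact: (continuous_pairing_rho (cQcn n))].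
have FG n t : `|F n t| <= G t.
  have b1 : `|pairing (j t) (fun x => odd_wave th (x, t) * cutoff n.+1%:R^-1 x)| <= nj t.
    rewrite -[nj t]mul1r; apply: pairing_bound => //.
      exact: (continuous_slice t (cQn n)).
    by move=> x _; apply: cut_le => p; exact: odd_wave_bound.
  have b2 : `|pairing (r t) (fun x => even_wave th' (x, t) * cutoff n.+1%:R^-1 x)|
      <= L * nr t.
    apply: pairing_bound => //; first exact: (continuous_slice t (cP'n n)).
    by move=> x _; apply: cut_le => p; exact: even_wave_bound.
  have b3 : `|pairing (j t) (fun x => odd_wave th' (x, t) * cutoff n.+1%:R^-1 x)|
      <= L * nj t.
    apply: pairing_bound => //; first exact: (continuous_slice t (cQ'n n)).
    by move=> x _; apply: cut_le => p; exact: odd_wave_bound.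
  have b4 : `|pairing (r t) (fun x => odd_wave th (x, t) * cutoff' n.+1%:R^-1 x)|
      <= 2 * L1 * nr t.
    apply: pairing_bound => //; first exact: (continuous_slice t (cQcn n)).
    move=> x Ix; rewrite normrM.
    apply: (@le_trans _ _ (L1 * (x * (1 - x)) * `|cutoff' n.+1%:R^-1 x|)).
      by rewrite ler_wpM2r// bdry.
    by rewrite -mulrA [leRHS]mulrC ler_wpM2l// cutoff'_bound.
  rewrite /F /G (le_trans (ler_normD _ _))// lerD// normrM ler_wpM2l//.
  rewrite (_ : (L + 2 * L1) * nr t + (L + `|2 * d|) * nj t =
    L * nr t + 2 * L1 * nr t + L * nj t + `|2 * d| * nj t); last by ring.
  rewrite (le_trans (ler_normB _ _))// lerD//; last first.
    by rewrite normrM ler_wpM2l.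
  rewrite (le_trans (ler_normB _ _))// lerD//.
  by rewrite (le_trans (ler_normD _ _))// lerD.
have cG : continuous G.
  apply: continuous_add; apply: continuous_mul => //.
  - by move=> t; apply: cvg_norm; exact: cchi'.
  - by move=> t; apply: cvg_norm; exact: cchi.
  - by apply: continuous_add; apply: continuous_mul => //; exact: cst_continuous.
have intF n : \int[mu]_(t in `[a, b]) F n t = 0.
  exact: (weak_momentum_cutoff UT Tchi (n0 n)).
have : \int[mu]_(t in `[a, b]) F n t @[n --> \oo] --> \int[mu]_(t in `[a, b]) F0 t.
  apply: (@Rintegral_dominated_cvg R _ _ mu `[a, b]%classic F F0 G).
  - exact: measurable_itv.
  - move=> n; apply: integrable_measurable_fun.
    exact: continuous_integrable_itv.
  - move=> t _; rewrite /F /F0.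
    have sQ := continuous_slice t cQ; have sQ' := continuous_slice t cQ'.
    have sP' := continuous_slice t cP'.
    have l1 := pairing_cutoff_cvg (ij t) sQ.
    have l2 := pairing_cutoff_cvg (ir t) sP'.
    have l3 := pairing_cutoff_cvg (ij t) sQ'.
    have l4 := pairing_cutoff'_cvg (ir t) sQ (bdry ^~ t) L10.
    apply: cvgD; first by apply: cvgMr; exact: l1.
    apply: cvgMr; apply: cvgB; last by apply: cvgMr; exact: l1.
    apply: cvgB; last exact: l3.
    by rewrite -[X in _ --> X]addr0; apply: cvgD; [exact: l2|exact: l4].
  - exact: continuous_integrable_itv.
  - by move=> n t _; exact: FG.
under eq_fun do rewrite intF.
by move=> /(cvg_unique _ (@cvg_cst _ _ _ _ _)) <-//.
Qed.

End weak_to_ode.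
Arguments continuous_slice {R} [a] t _.

(** * Mass of a test function and averaging over reflections *)

Section wave_pairing.
Variable R : realType.
Local Notation mu := (@lebesgue_measure R).

(** The integral of [th] over the period [[-1, 1]], folded onto [I]. *)
Definition mass (th : R -> R) : R := \int[mu]_(x in I01 R) (th x + th (- x)).

(** This is [W theta t] in the variables [rho] and [J]; [wave_pairingE] gives its form in [f^+] and
    [f^-]. *)
Definition wave_pairing (rho J : R -> R -> R) (th : R -> R) (t : R) : R :=
  pairing (time_slice rho t) (fun x => even_wave th (x, t)) +
  pairing (time_slice J t) (fun x => odd_wave th (x, t)).

Lemma antiderivative_period (th th' Th : R -> R) : circle_test th th' ->
  (forall y : R, is_derive y 1 Th (th y)) ->
  forall y z, Th (y + 2) - Th y = Th (z + 2) - Th z.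
Proof.
move=> T dTh; apply: (@derive_eq0_cst R (fun y => Th (y + 2) - Th y)) => y.
have d2 : is_derive y 1 (fun y => Th (y + 2)) (th (y + 2)).
  by have := is_derive_comp_sub (- 2) dTh y; rewrite opprK.
apply: (is_derive_ext (is_deriveB d2 (dTh y))) => //.
by rewrite (circle_periodic T) subrr.
Qed.

(** Both sides are increments over one period of an antiderivative of [th], and such an increment
    does not depend on where the period starts. *)
Lemma mass_translate (th th' : R -> R) (c : R) : circle_test th th' ->
  \int[mu]_(x in I01 R) (th (x - c) + th (- x - c)) = mass th.
Proof.
move=> T; have cth := circle_continuous T.
have [Th dTh] := antiderivative cth.
have H a : \int[mu]_(x in I01 R) (th (x - a) + th (- x - a)) = Th (1 - a) - Th (- 1 - a).
  have dF (x : R) : is_derive x 1 (fun x => Th (x - a) - Th (- x - a))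
      (th (x - a) + th (- x - a)).
    apply: (is_derive_ext (is_deriveB (is_derive_comp_sub a dTh x)
      (is_derive_comp_refl a dTh x))) => //.
    by rewrite opprK.
  rewrite /I01 (Rintegral_derive ler01 _ dF); first by rewrite oppr0; ring.
  apply: continuous_add => x.
    apply: (@continuous_comp _ _ _ (fun x => x - a) th); last exact: cth.
    by apply: cvgB; [exact: cvg_id|exact: cvg_cst].
  apply: (@continuous_comp _ _ _ (fun x => - x - a) th); last exact: cth.
  by apply: cvgB; [apply: cvgN; exact: cvg_id|exact: cvg_cst].
rewrite H /mass.
transitivity (\int[mu]_(x in I01 R) (th (x - 0) + th (- x - 0))).
  rewrite H; have := antiderivative_period T dTh (- 1 - c) (- 1 - 0).
  rewrite (_ : - 1 - c + 2 = 1 - c); last ring.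
  by rewrite (_ : - 1 - 0 + 2 = 1 - 0)//; ring.
by apply: eq_Rintegral => x _; rewrite !subr0.
Qed.

Lemma mass_reflect (c : R) (th th' : R -> R) : unit_test th th' ->
  mass (reflect_test c th) = mass th.
Proof.
move=> [T _]; rewrite -(mass_translate c T); apply: eq_Rintegral => x _.
by rewrite /reflect_test opprK addrC.
Qed.

Lemma continuous_mass_integrand (th th' : R -> R) : circle_test th th' ->
  continuous (fun x => th x + th (- x)).
Proof.
move=> T; apply: continuous_add; first exact: circle_continuous T.
move=> x; apply: (@continuous_comp _ _ _ (fun x => - x) th).
  by apply: cvgN; exact: cvg_id.
exact: (circle_continuous T).
Qed.

Lemma mass_bound (th th' : R -> R) : unit_test th th' -> 0 <= mass th <= 2.
Proof.
move=> [T th01]; rewrite /mass Rintegral_ge0/=; last first.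
  by move=> x _; rewrite addr_ge0//; case/andP: (th01 x); case/andP: (th01 (- x)).
have -> : (2 : R) = \int[mu]_(x in I01 R) 2.
  rewrite Rintegral_cst; last exact: measurable_I01.
  rewrite [X in fine X](_ : _ = 1%E) ?mulr1//.
  by rewrite [LHS]lebesgue_measure_itv/= lte_fin ltr01 oppr0 adde0.
apply: le_Rintegral.
- exact: measurable_I01.
- exact/continuous_integrable_itv/(continuous_mass_integrand T).
- exact/continuous_integrable_itv/cst_continuous.
- move=> x _; have /andP[_ h1] := th01 x; have /andP[_ h2] := th01 (- x); lra.
Qed.

(** The reflection exchanges the characteristic arguments [x - t] and [- x - t], so it fixes the
    even wave and, in [odd_wave_reflect], negates the odd one. *)
Lemma even_wave_reflect (th : R -> R) (x t : R) :
  even_wave (reflect_test (2 * t) th) (x, t) = even_wave th (x, t).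
Proof.
rewrite /even_wave /reflect_test/=.
rewrite (_ : - (x - t) - 2 * t = - x - t); last by ring.
rewrite (_ : - (- x - t) - 2 * t = x - t); last by ring.
by rewrite [th _ + _]addrC.
Qed.

Lemma odd_wave_reflect (th : R -> R) (x t : R) :
  odd_wave (reflect_test (2 * t) th) (x, t) = - odd_wave th (x, t).
Proof.
rewrite /odd_wave /reflect_test/=.
rewrite (_ : - (x - t) - 2 * t = - x - t); last by ring.
rewrite (_ : - (- x - t) - 2 * t = x - t); last by ring.
by rewrite -mulNr opprB.
Qed.

Lemma is_derive_pairing (u : R -> R) (a a_t : R * R -> R) (C : R) :
  mu.-integrable (I01 R) (EFin \o u) -> continuous a ->
  (forall x t : R, is_derive t 1 (fun s => a (x, s)) (a_t (x, t))) ->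
  (forall p, `|a_t p| <= C) ->
  forall t : R, is_derive t 1 (fun s => pairing u (fun x => a (x, s)))
    (pairing u (fun x => a_t (x, t))).
Proof.
move=> iu ca da aC t; have mI := @measurable_I01 R.
have C0 : 0 <= C by apply: le_trans (aC (0, 0)).
have It : `]t - 1, t + 1[%classic t by rewrite /= in_itv/=; apply/andP; split; lra.
have iua s : mu.-integrable (I01 R) (EFin \o (fun x => u x * a (x, s))).
  exact/integrableM_continuous/continuous_slice.
have dua (s x : R) : is_derive s 1 (fun s => u x * a (x, s)) (u x * a_t (x, s)).
  exact: (is_derive_ext (is_deriveZ (u x) (da x s))).
have d1 s x : (fun s => u x * a (x, s))^`()%classic s = u x * a_t (x, s).
  by rewrite derive1E; have [_ ->] := dua s x.
have iG : mu.-integrable (I01 R) (EFin \o (fun x => C * `|u x|)).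
  exact/integrableZ_I/integrable_norm.
have G0 x : 0 <= C * `|u x| by rewrite mulr_ge0.
have derf1 s x : `]t - 1, t + 1[%classic s -> I01 R x ->
    derivable (fun s => u x * a (x, s)) s 1.
  by move=> _ _; have [] := dua s x.
have Gub s x : `]t - 1, t + 1[%classic s -> I01 R x ->
    `|partial1of2 (fun s x => u x * a (x, s)) s x| <= C * `|u x|.
  by move=> _ _; rewrite /partial1of2 d1 normrM mulrC ler_wpM2r.
apply/is_derive_of_derive1; split.
  exact: (derivable_under_integral mI It (fun s _ => iua s) derf1 G0 iG Gub).
rewrite (differentiation_under_integral mI It (fun s _ => iua s) derf1 G0 iG Gub).
by apply: eq_Rintegral => x _; rewrite /partial1of2 d1.
Qed.

Variables (d : R) (rho0 J0 : R -> R) (rho J : R -> R -> R).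
Hypothesis weak : weak_solution d rho0 J0 rho J.

Let r := time_slice rho.
Let j := time_slice J.
Let ir t := (integrable_time_slice weak t).1.
Let ij t := (integrable_time_slice weak t).2.

Lemma continuous_wave_pairing th : continuous th -> continuous (wave_pairing rho J th).
Proof.
move=> cth; apply: continuous_add.
  exact: (continuous_pairing_rho weak (continuous_even_wave cth)).
exact: (continuous_pairing_J weak (continuous_odd_wave cth)).
Qed.

(** In the sum of the two weak identities all pairings with [th'] cancel, because the waves solve
    the undamped adjoint system. Only the damping remains, and the du Bois-Reymond lemma applies. *)
Lemma wave_pairing_derive th th' : unit_test th th' -> forall t : R, 0 < t ->
  is_derive t 1 (wave_pairing rho J th)
    (- (2 * d) * pairing (j t) (fun x => odd_wave th (x, t))).
Proof.
move=> UT; have [T _] := UT.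
have cth := circle_continuous T; have cth' := circle_continuous_derive T.
have cW := continuous_wave_pairing cth.
have cjQ := continuous_pairing_J weak (continuous_odd_wave cth).
have cjQ' := continuous_pairing_J weak (continuous_odd_wave cth').
have crP := continuous_pairing_rho weak (continuous_even_wave cth).
have crP' := continuous_pairing_rho weak (continuous_even_wave cth').
apply: (@du_bois_reymond R
  (fun t => - (2 * d) * pairing (j t) (fun x => odd_wave th (x, t)))) => //.
  by apply: continuous_mul => //; exact: cst_continuous.
move=> a b chi chi' a0 ab cchi' dchi supp.
have Tchi : time_test a b chi chi' by split.
have cchi := is_derive_continuous dchi.
have h1 := weak_mass_waves weak UT Tchi.
have h2 := weak_momentum_waves weak UT Tchi.
rewrite -[RHS](addr0 0) -{1}h1 -h2 -RintegralD//.
- by apply: eq_Rintegral => t _; rewrite /wave_pairing -/r -/j; ring.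
- apply: continuous_integrable_itv; apply: continuous_add; apply: continuous_mul => //.
  by move=> t; apply: cvgB; [exact: cjQ'|exact: crP'].
- apply: continuous_integrable_itv; apply: continuous_add; apply: continuous_mul => //.
  move=> t; apply: cvgB; last by apply: cvgMr; exact: cjQ.
  by apply: cvgB; [exact: crP'|exact: cjQ'].
Qed.

(** Reflecting the test changes the wave pairing by minus twice its odd part, which is how the
    damping becomes a gain minus a loss. *)
Lemma wave_pairing_transport : reflected_transport d (wave_pairing rho J) mass.
Proof.
split.
- by move=> th th' [T _]; exact/continuous_wave_pairing/(circle_continuous T).
- move=> th th' UT t t0.
  have [T _] := UT; have cQ := continuous_odd_wave (circle_continuous T).
  apply: (is_derive_ext (wave_pairing_derive UT t0)) => //.
  rewrite /wave_pairing (_ : (fun x => odd_wave (reflect_test _ _) _) =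
    fun x => - 1 * odd_wave th (x, t)); last first.
    by apply/funext => x; rewrite odd_wave_reflect mulN1r.
  rewrite pairingZ; [|exact: ij|exact: continuous_slice].
  rewrite (_ : (fun x => even_wave (reflect_test _ _) _) =
    fun x => even_wave th (x, t)); first by rewrite -/j; ring.
  by apply/funext => x; exact: even_wave_reflect.
- exists (fun t => \int[mu]_(x in I01 R) `|r t x| + \int[mu]_(x in I01 R) `|j t x|).
    by apply: continuous_add; apply: L1_norm_continuous => //;
      have [] := time_slice_L1 weak.
  move=> th th' [T th01] t; have cth := circle_continuous T.
  have th1 y : `|th y| <= 1 by have /andP[y0 y1] := th01 y; rewrite ger0_norm.
  rewrite /wave_pairing (le_trans (ler_normD _ _))// lerD//.
    rewrite -[leRHS]mul1r; apply: pairing_bound; [exact: ir|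
      exact/continuous_slice/continuous_even_wave|].
    by move=> x _; exact: even_wave_bound.
  rewrite -[leRHS]mul1r; apply: pairing_bound; [exact: ij|
    exact/continuous_slice/continuous_odd_wave|].
  by move=> x _; exact: odd_wave_bound.
- by move=> c th th'; exact: mass_reflect.
- exact: mass_bound.
Qed.

(** While [s] runs over [[0, 1]], the waves of an antiderivative [Th] run through one period. There
    [Th] shifts by the constant [K]: the odd wave returns to itself, and the even wave changes by a
    constant, which pairs to zero with a density of mean zero. *)
Lemma reflected_average (rho0_mean : \int[mu]_(x in I01 R) r 0 x = 0) th th' :
  unit_test th th' -> exists2 Z : R -> R, Z 1 = Z 0 &
  forall s : R, is_derive s 1 Z (wave_pairing rho J (reflect_test (2 * s) th) 0).
Proof.
move=> [T th01]; have cth := circle_continuous T.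
have th1 y : `|th y| <= 1 by have /andP[y0 y1] := th01 y; rewrite ger0_norm.
have [Th dTh] := antiderivative cth.
have cTh := is_derive_continuous dTh.
pose E t := pairing (r 0) (fun x => even_wave Th (x, t)).
pose O t := pairing (j 0) (fun x => odd_wave Th (x, t)).
have dE : forall t : R, is_derive t 1 E (pairing (r 0) (fun x => - even_wave th (x, t))).
  apply: (@is_derive_pairing _ _ (fun p => - even_wave th p) 1 (ir 0)).
  - exact: continuous_even_wave.
  - by move=> x t; exact: even_wave_derive_t.
  - by move=> p; rewrite normrN even_wave_bound.
have dO : forall t : R, is_derive t 1 O (pairing (j 0) (fun x => - odd_wave th (x, t))).
  apply: (@is_derive_pairing _ _ (fun p => - odd_wave th p) 1 (ij 0)).
  - exact: continuous_odd_wave.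
  - by move=> x t; exact: odd_wave_derive_t.
  - by move=> p; rewrite normrN odd_wave_bound.
have pairingN u b : mu.-integrable (I01 R) (EFin \o u) -> continuous b ->
    pairing u (fun x => - b x) = - pairing u b.
  move=> iu cb; rewrite -mulN1r -pairingZ//; congr pairing.
  by apply/funext => x; rewrite mulN1r.
(* The factor [2^-1] offsets the speed of the argument [2 * s], its sign offsets the minus sign in
   the time derivative of a wave, and [O] is subtracted because the reflection negates odd waves. *)
exists (fun s => - 2^-1 * (E (2 * s) - O (2 * s))).
  have per := antiderivative_period T dTh.
  pose K := Th 2 - Th 0.
  have hE x : even_wave Th (x, 2) = even_wave Th (x, 0) + - K * 1.
    rewrite /even_wave /K/=; have := per (x - 2) 0; have := per (- x - 2) 0.
    by rewrite !subrK add0r !subr0; lra.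
  have hO x : odd_wave Th (x, 2) = odd_wave Th (x, 0).
    rewrite /odd_wave/=; have := per (x - 2) 0; have := per (- x - 2) 0.
    by rewrite !subrK add0r !subr0; lra.
  congr (_ * (_ - _)); rewrite mulr1 mulr0 /E /O.
    under eq_fun do rewrite hE.
    rewrite pairingD; [|exact: ir|exact/continuous_slice/continuous_even_wave|
      exact: cst_continuous].
    rewrite pairingZ; [|exact: ir|exact: cst_continuous].
    rewrite /pairing; under [X in - K * X]eq_Rintegral do rewrite mulr1.
    by rewrite rho0_mean mulr0 addr0.
  by under eq_fun do rewrite hO.
move=> s.
have d2 (y : R) : is_derive y 1 (fun y => 2 * y) 2.
  apply: (is_derive_ext (is_deriveZ (2 : R) (is_derive_id (y : R) (1 : R)))) => //.
  by rewrite -[_ *: _]/(_ * _) mulr1.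
have dE2 := @is_derive1_comp _ E (fun y => 2 * y) s _ _ (dE (2 * s)) (d2 s).
have dO2 := @is_derive1_comp _ O (fun y => 2 * y) s _ _ (dO (2 * s)) (d2 s).
apply: (is_derive_ext (is_deriveZ (- 2^-1 : R) (is_deriveB dE2 dO2))) => //.
have cP := continuous_slice (2 * s) (continuous_even_wave cth).
have cQ := continuous_slice (2 * s) (continuous_odd_wave cth).
rewrite -[_ *: _]/(_ * _) /wave_pairing -/r -/j !pairingN//.
have -> : (fun x => even_wave (reflect_test (2 * s) th) (x, 0)) =
    (fun x => even_wave th (x, 2 * s)).
  by apply/funext => x; rewrite /even_wave /reflect_test/= !subr0 opprK [th _ + _]addrC.
have -> : (fun x => odd_wave (reflect_test (2 * s) th) (x, 0)) =
    (fun x => - odd_wave th (x, 2 * s)).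
  apply/funext => x; rewrite /odd_wave /reflect_test/= !subr0 opprK.
  by rewrite -[RHS]mulNr opprB.
by rewrite pairingN//; field.
Qed.

End wave_pairing.

(** * Decay of the essential oscillation *)

Section characteristic_bounds.
Variable R : realType.
Local Notation mu := (@lebesgue_measure R).

Lemma ae_ge0_Rintegral (h : R -> R) : mu.-integrable (I01 R) (EFin \o h) ->
  {ae mu, forall x, I01 R x -> 0 <= h x} -> 0 <= \int[mu]_(x in I01 R) h x.
Proof.
move=> ih h0; have mI := @measurable_I01 R.
suff -> : \int[mu]_(x in I01 R) h x = \int[mu]_(x in I01 R) `|h x|.
  exact: Rintegral_ge0.
have aeF := ae_filter_ringOfSetsType mu.
rewrite /Rintegral; congr fine; apply: ae_eq_integral => //.
- exact: measurable_int ih.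
- exact: (measurable_int mu (integrable_norm ih)).
- by apply: filterS h0 => x /= h0 Ix; rewrite ger0_norm ?h0.
Qed.

Definition characteristic_pairing (g h : R -> R) (th : R -> R) (t : R) : R :=
  \int[mu]_(x in I01 R) (g x * th (x - t) + h x * th (- x - t)).

Lemma integrable_characteristic (g h : R -> R) (th : R -> R) (t : R) :
  mu.-integrable (I01 R) (EFin \o g) -> mu.-integrable (I01 R) (EFin \o h) ->
  continuous th ->
  mu.-integrable (I01 R)
    (EFin \o (fun x => g x * th (x - t) + h x * th (- x - t))).
Proof.
move=> ig ih cth; have [c1 c2] := continuous_characteristics cth.
by apply: integrableD_I; apply: integrableM_continuous => //;
  [exact: (continuous_slice t c1)|exact: (continuous_slice t c2)].
Qed.

Lemma characteristic_pairingN (g h : R -> R) (th : R -> R) (t : R) :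
  mu.-integrable (I01 R) (EFin \o g) -> mu.-integrable (I01 R) (EFin \o h) ->
  continuous th ->
  characteristic_pairing (fun x => - g x) (fun x => - h x) th t =
  - characteristic_pairing g h th t.
Proof.
move=> ig ih cth; rewrite /characteristic_pairing -[RHS]mulN1r -RintegralZl.
- by apply: eq_Rintegral => x _; ring.
- exact: measurable_I01.
- exact: integrable_characteristic.
Qed.

Lemma characteristic_pairing_le (g h : R -> R) (M : R) (th th' : R -> R) (t : R) :
  mu.-integrable (I01 R) (EFin \o g) -> mu.-integrable (I01 R) (EFin \o h) ->
  {ae mu, forall x, I01 R x -> g x <= M} -> {ae mu, forall x, I01 R x -> h x <= M} ->
  unit_test th th' -> characteristic_pairing g h th t <= M * mass th.
Proof.
move=> ig ih gM hM [T th01]; have cth := circle_continuous T.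
have mI := @measurable_I01 R.
have icst : mu.-integrable (I01 R) (EFin \o (fun=> M)).
  exact/continuous_integrable_itv/cst_continuous.
rewrite -(mass_translate t T) -subr_ge0 /characteristic_pairing.
have -> : M * \int[mu]_(x in I01 R) (th (x - t) + th (- x - t)) =
    characteristic_pairing (fun=> M) (fun=> M) th t.
  rewrite -RintegralZl//.
    by apply: eq_Rintegral => x _; rewrite mulrDr.
  have [c1 c2] := continuous_characteristics cth.
  apply: continuous_integrable_itv; apply: continuous_add.
    exact: (continuous_slice t c1).
  exact: (continuous_slice t c2).
rewrite -RintegralB//; [|exact: integrable_characteristic..].
apply: ae_ge0_Rintegral.
  by apply: integrableB_I; exact: integrable_characteristic.
have aeF := ae_filter_ringOfSetsType mu.
apply: filterS2 gM hM => x /= gM hM Ix.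
have /andP[h1 _] := th01 (x - t); have /andP[h2 _] := th01 (- x - t).
have g1 := gM Ix; have g2 := hM Ix.
rewrite [leRHS](_ : _ = (M - g x) * th (x - t) + (M - h x) * th (- x - t)); last by ring.
by rewrite addr_ge0// mulr_ge0// subr_ge0.
Qed.

(** The test has to be moved back by [t]. Two successive reflections make a translation, which gives
    the bound on [g]; a single one also exchanges the roles of [g] and [h], which gives the bound on
    [h]. *)
Lemma ae_le_of_characteristic_pairing (g h : R -> R) (M t : R) :
  mu.-integrable (I01 R) (EFin \o g) -> mu.-integrable (I01 R) (EFin \o h) ->
  (forall th th', unit_test th th' -> characteristic_pairing g h th t <= M * mass th) ->
  {ae mu, forall x, I01 R x -> g x <= M} /\ {ae mu, forall x, I01 R x -> h x <= M}.
Proof.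
move=> ig ih H; split; apply: ae_le_of_circle_tests => //; [exact: ih| |exact: ig|].
  move=> th th' T th01; have UT : unit_test th th' by [].
  have UT0 := unit_test_reflect 0 UT; have UT1 := unit_test_reflect t UT0.
  have := H _ _ UT1; rewrite !(mass_reflect _ UT0, mass_reflect _ UT); apply: le_trans.
  rewrite le_eqVlt; apply/orP; left; apply/eqP; apply: eq_Rintegral => x _.
  by rewrite /reflect_test; congr (_ * th _ + _ * th _); ring.
move=> th th' T th01; have UT : unit_test th th' by [].
have UT1 := unit_test_reflect t UT.
have := H _ _ UT1; rewrite (mass_reflect _ UT); apply: le_trans.
rewrite le_eqVlt; apply/orP; left; apply/eqP; apply: eq_Rintegral => x _.
by rewrite /reflect_test addrC; congr (_ * th _ + _ * th _); ring.
Qed.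

Lemma unit_test_cst1 : unit_test (fun=> 1 : R) (fun=> 0).
Proof.
split; last by move=> y; rewrite ler01 lexx.
split.
- by [].
- by move=> y; exact: is_derive_cst.
- exact: cst_continuous.
- by exists 0 => y; rewrite normr0.
Qed.

Lemma mass_cst1 : mass (fun=> 1 : R) = 2.
Proof.
rewrite /mass Rintegral_cst; last exact: measurable_I01.
rewrite [X in fine X](_ : _ = 1%E) ?mulr1//.
by rewrite [LHS]lebesgue_measure_itv/= lte_fin ltr01 oppr0 adde0.
Qed.

End characteristic_bounds.

Section decay.
Variable R : realType.
Local Notation mu := (@lebesgue_measure R).
Variables (d : R) (rho0 J0 : R -> R) (rho J : R -> R -> R).
Hypothesis weak : weak_solution d rho0 J0 rho J.
Let fp (t x : R) := (rho x t + J x t) / 2.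
Let fm (t x : R) := (rho x t - J x t) / 2.

Lemma integrable_riemann_invariants t : 0 <= t ->
  mu.-integrable (I01 R) (EFin \o fp t) /\ mu.-integrable (I01 R) (EFin \o fm t).
Proof.
move=> t0; have [/Linfty_integrable ir /Linfty_integrable ij] := weak_Linfty weak t0.
split.
  have := integrableZ_I 2^-1 (integrableD_I ir ij).
  by apply: eq_integrable; [exact: measurable_I01|move=> x _ /=; rewrite mulrC].
have := integrableZ_I 2^-1 (integrableB_I ir ij).
by apply: eq_integrable; [exact: measurable_I01|move=> x _ /=; rewrite mulrC].
Qed.

Lemma wave_pairingE th t : continuous th -> 0 <= t ->
  wave_pairing rho J th t = characteristic_pairing (fp t) (fm t) th t.
Proof.
move=> cth t0; have [ir ij] := integrable_time_slice weak t.
rewrite /wave_pairing -Rintegral_pairingD//.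
- apply: eq_Rintegral => x _.
  by rewrite /time_slice pospart_id// /even_wave /odd_wave /fp /fm/=; field.
- exact/continuous_slice/continuous_even_wave.
- exact/continuous_slice/continuous_odd_wave.
Qed.

Variables m M : R.
Hypothesis d_gt0 : 0 < d.
Hypothesis rho0_Linfty : in_Linfty_I rho0.
Hypothesis rho0_mean : \int[mu]_(x in I01 R) rho0 x = 0.
Hypothesis fp0_bounds :
  {ae mu, forall x, I01 R x -> m <= (rho0 x + J0 x) / 2 <= M}.
Hypothesis fm0_bounds :
  {ae mu, forall x, I01 R x -> m <= (rho0 x - J0 x) / 2 <= M}.

Lemma initial_bounds :
  {ae mu, forall x, I01 R x -> m <= fp 0 x <= M /\ m <= fm 0 x <= M}.
Proof.
have aeF := ae_filter_ringOfSetsType mu.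
have [er ej] := weak_initial weak.
apply: filterS2 (filterI er ej) (filterI fp0_bounds fm0_bounds) => x /=.
by move=> [er0 ej0] [bp bm] Ix; rewrite /fp /fm er0// ej0//; split; [exact: bp|exact: bm].
Qed.

Lemma initial_pairing_bounds th th' : unit_test th th' ->
  m * mass th <= wave_pairing rho J th 0 <= M * mass th.
Proof.
move=> UT; have cth := circle_continuous UT.1.
have aeF := ae_filter_ringOfSetsType mu.
have [ip im] := integrable_riemann_invariants (lexx 0).
rewrite wave_pairingE//; apply/andP; split; last first.
  by apply: (characteristic_pairing_le 0 ip im _ _ UT); apply: filterS initial_bounds
    => x /= h /h [/andP[_ h1] /andP[_ h2]].
have ipN : mu.-integrable (I01 R) (EFin \o (fun x => - fp 0 x)).
  by have := integrableZ_I (- 1) ip; apply: eq_integrable;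
    [exact: measurable_I01|move=> x _ /=; rewrite mulN1r].
have imN : mu.-integrable (I01 R) (EFin \o (fun x => - fm 0 x)).
  by have := integrableZ_I (- 1) im; apply: eq_integrable;
    [exact: measurable_I01|move=> x _ /=; rewrite mulN1r].
rewrite -lerN2 -characteristic_pairingN// -mulNr.
by apply: (characteristic_pairing_le 0 ipN imN _ _ UT); apply: filterS initial_bounds
  => x /= h /h [/andP[h1 _] /andP[h2 _]]; rewrite lerN2.
Qed.

Lemma initial_slice_mean : \int[mu]_(x in I01 R) time_slice rho 0 x = 0.
Proof.
rewrite -[RHS]rho0_mean /Rintegral; congr fine.
have [er _] := weak_initial weak.
have [ir _] := integrable_time_slice weak 0.
apply: ae_eq_integral.
- exact: measurable_I01.
- exact: (measurable_int mu ir).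
- exact: (measurable_int mu (Linfty_integrable rho0_Linfty)).
- have aeF := ae_filter_ringOfSetsType mu.
  by apply: filterS er => x /= h Ix; rewrite /time_slice pospart_id// h.
Qed.

(** The constant test [1] has mass [2], and its pairing at time [0] is the integral of [rho0],
    namely zero. Consequently [M - m] dominates both [M] and [- m], hence the solution in absolute
    value. *)
Lemma bounds_sign : m <= 0 <= M.
Proof.
have := initial_pairing_bounds (unit_test_cst1 R).
rewrite mass_cst1 (_ : wave_pairing _ _ _ _ = 0).
  by move=> /andP[h1 h2]; apply/andP; split; lra.
rewrite /wave_pairing (_ : (fun x => even_wave _ _) = fun=> 1); last first.
  by apply/funext => x; rewrite /even_wave; field.
rewrite (_ : (fun x => odd_wave _ _) = fun=> 0); last first.
  by apply/funext => x; rewrite /odd_wave subrr mul0r.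
have -> : pairing (time_slice J 0) (fun=> 0) = 0.
  by apply: Rintegral_I01_eq0 => x; rewrite mulr0.
rewrite addr0 /pairing.
by under eq_Rintegral do rewrite mulr1; exact: initial_slice_mean.
Qed.

Let K := M - m.

(** The first alternative is the maximum principle from time [0]. The second narrows the gap to
    [(1 - d + 4 * d ^+ 2) * K]: the contraction gives it at time [1], and the maximum principle
    restarted there preserves it. Lower bounds come from the negated functional. *)
Lemma wave_pairing_decay (m1 M1 : R) :
  (m1 = m /\ M1 = M) \/
  (d <= 1 /\ m1 = (1 - d) * m - 2 * d ^+ 2 * K /\ M1 = (1 - d) * M + 2 * d ^+ 2 * K) ->
  forall th th', unit_test th th' -> forall t, 1 <= t ->
  m1 * mass th <= wave_pairing rho J th t <= M1 * mass th.
Proof.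
have d0 := ltW d_gt0.
have T := wave_pairing_transport weak.
have TN := reflected_transportN T.
have up0 th th' : unit_test th th' -> wave_pairing rho J th 0 <= M * mass th.
  by move=> UT; have /andP[] := initial_pairing_bounds UT.
have lo0 th th' : unit_test th th' -> - wave_pairing rho J th 0 <= - m * mass th.
  by move=> UT; have /andP[] := initial_pairing_bounds UT; rewrite mulNr lerN2.
have up := maximum_principle d0 (lexx 0) T up0.
have lo := maximum_principle d0 (lexx 0) TN lo0.
case=> [[-> ->]|[d1 [-> ->]]] th th' UT t t1.
  have t0 : 0 <= t by rewrite (le_trans ler01).
  by rewrite (up _ _ UT t t0) andbT -lerN2 -mulNr; exact: (lo _ _ UT t t0).
have /andP[m0 M0] := bounds_sign.
have WK th1 th1' : unit_test th1 th1' -> forall s, 0 <= s ->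
    `|wave_pairing rho J th1 s| <= K * mass th1.
  move=> U1 s s0; have h1 := up _ _ U1 s s0; have h2 := lo _ _ U1 s s0.
  have /andP[ms0 _] := mass_bound U1.
  rewrite ler_norml /K; apply/andP; split; nra.
have WKN th1 th1' : unit_test th1 th1' -> forall s, 0 <= s ->
    `|- wave_pairing rho J th1 s| <= K * mass th1.
  by move=> U1 s s0; rewrite normrN; exact: (WK _ _ U1).
have avg := reflected_average weak initial_slice_mean.
have avgN th1 th1' : unit_test th1 th1' -> exists2 Z : R -> R, Z 1 = Z 0 &
    forall s : R, is_derive s 1 Z (- wave_pairing rho J (reflect_test (2 * s) th1) 0).
  move=> U1; have [Z Z10 dZ] := avg _ _ U1.
  exists (fun s => - Z s); first by rewrite Z10.
  by move=> s; apply: is_deriveN; exact: dZ.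
have up1 := transport_contraction d0 d1 T WK up0 avg.
have lo1 := transport_contraction d0 d1 TN WKN lo0 avgN.
rewrite (maximum_principle d0 ler01 T up1 UT t1) andbT -lerN2.
rewrite (_ : - (_ * mass th) = ((1 - d) * - m + 2 * d ^+ 2 * K) * mass th); last by ring.
exact: (maximum_principle d0 ler01 TN lo1 UT t1).
Qed.

Lemma riemann_invariant_bounds (m1 M1 t : R) : 0 <= t ->
  (forall th th', unit_test th th' ->
    m1 * mass th <= wave_pairing rho J th t <= M1 * mass th) ->
  {ae mu, forall x, I01 R x -> m1 <= fp t x <= M1 /\ m1 <= fm t x <= M1}.
Proof.
move=> t0 H; have [ip im] := integrable_riemann_invariants t0.
have aeF := ae_filter_ringOfSetsType mu.
have ipN : mu.-integrable (I01 R) (EFin \o (fun x => - fp t x)).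
  by have := integrableZ_I (- 1) ip; apply: eq_integrable;
    [exact: measurable_I01|move=> x _ /=; rewrite mulN1r].
have imN : mu.-integrable (I01 R) (EFin \o (fun x => - fm t x)).
  by have := integrableZ_I (- 1) im; apply: eq_integrable;
    [exact: measurable_I01|move=> x _ /=; rewrite mulN1r].
have [|up1 up2] := @ae_le_of_characteristic_pairing R (fp t) (fm t) M1 t ip im.
  move=> th th' UT; rewrite -wave_pairingE//; last exact: circle_continuous UT.1.
  by have /andP[] := H _ _ UT.
have [|lo1 lo2] := @ae_le_of_characteristic_pairing R (fun x => - fp t x)
    (fun x => - fm t x) (- m1) t ipN imN.
  move=> th th' UT; have cth := circle_continuous UT.1.
  rewrite characteristic_pairingN// -wave_pairingE// mulNr lerN2.
  by have /andP[] := H _ _ UT.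
apply: filterS2 (filterI up1 up2) (filterI lo1 lo2) => x /= [u1 u2] [l1 l2] Ix.
have := l1 Ix; have := l2 Ix; rewrite !lerN2 => -> ->.
by rewrite u1// u2.
Qed.

End decay.

(** * Joint essential bounds of a pair of functions *)

Section essential_oscillation.
Variable R : realType.
Local Notation mu := (@lebesgue_measure R).

Lemma ess_pm_bounds (f g : R -> R) (m M : R) :
  {ae mu, forall x, I01 R x -> m <= f x <= M /\ m <= g x <= M} ->
  (ess_sup_pm f g <= M%:E)%E /\ (m%:E <= ess_inf_pm f g)%E.
Proof.
move=> H; have aeF := ae_filter_ringOfSetsType mu; split.
  rewrite /ess_sup_pm ge_max; apply/andP; split; apply/ess_supP; apply/ae_lebIP;
    by apply: filterS H => x /= h /h [/andP[_ h1] /andP[_ h2]]; rewrite lee_fin.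
rewrite /ess_inf_pm le_min; apply/andP; split; apply/ess_infP; apply/ae_lebIP;
  by apply: filterS H => x /= h /h [/andP[h1 _] /andP[h2 _]]; rewrite lee_fin.
Qed.

Lemma ess_pm_attained (f g : R -> R) : 
  (exists B : R, {ae mu, forall x, I01 R x -> - B <= f x <= B /\ - B <= g x <= B}) ->
  exists m M : R, [/\ ess_sup_pm f g = M%:E, ess_inf_pm f g = m%:E,
    {ae mu, forall x, I01 R x -> m <= f x <= M} &
    {ae mu, forall x, I01 R x -> m <= g x <= M}].
Proof.
move=> [B H]; have aeF := ae_filter_ringOfSetsType mu.
have [SB BI] := ess_pm_bounds H.
have IS : (ess_inf_pm f g <= ess_sup_pm f g)%E.
  rewrite /ess_inf_pm /ess_sup_pm ge_min le_max; apply/orP; left; apply/orP; left.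
  (* On a space of mass zero the essential infimum would be [+oo] and the supremum [-oo], so
     positivity of the total mass enters here. *)
  apply: ess_sup_gee; first exact: lebI_setT_gt0.
  exact: ess_inf_le.
have fS : ess_sup_pm f g \is a fin_num.
  rewrite fin_numElt (lt_le_trans (ltNyr _) (le_trans BI IS)).
  exact: (le_lt_trans SB (ltry _)).
have fI : ess_inf_pm f g \is a fin_num.
  rewrite fin_numElt (lt_le_trans (ltNyr _) BI).
  exact: (le_lt_trans IS (le_lt_trans SB (ltry _))).
exists (fine (ess_inf_pm f g)), (fine (ess_sup_pm f g)).
have hf : {ae mu, forall x, I01 R x ->
    (ess_inf_pm f g <= (f x)%:E <= ess_sup_pm f g)%E}.
  apply/ae_lebIP; apply: filterS2 (ess_inf_le (lebI R) (EFin \o f))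
    (ess_sup_ge (lebI R) (EFin \o f)) => x /= h1 h2.
  rewrite /ess_inf_pm /ess_sup_pm ge_min le_max h1 h2//.
have hg : {ae mu, forall x, I01 R x ->
    (ess_inf_pm f g <= (g x)%:E <= ess_sup_pm f g)%E}.
  apply/ae_lebIP; apply: filterS2 (ess_inf_le (lebI R) (EFin \o g))
    (ess_sup_ge (lebI R) (EFin \o g)) => x /= h1 h2.
  by rewrite /ess_inf_pm /ess_sup_pm ge_min le_max h1 h2 !orbT.
split; rewrite ?fineK//.
  by apply: filterS hf => x /= h /h; rewrite -!lee_fin !fineK.
by apply: filterS hg => x /= h /h; rewrite -!lee_fin !fineK.
Qed.

End essential_oscillation.

Theorem theorem1p2 (R : realType) :
  exists (dstar : R) (C : R -> R),
    [/\ 0 < dstar,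
        forall d : R, 0 < d -> d < dstar -> 0 < C d < 1 &
        forall (d : R) (rho0 J0 : R -> R) (rho J : R -> R -> R),
          0 < d ->
          in_Linfty_I rho0 -> in_Linfty_I J0 ->
          \int[lebesgue_measure]_(x in I01 R) rho0 x = 0 ->
          weak_solution d rho0 J0 rho J ->
          let fp (t x : R) := (rho x t + J x t) / 2 in
          let fm (t x : R) := (rho x t - J x t) / 2 in
          let fp0 (x : R) := (rho0 x + J0 x) / 2 in
          let fm0 (x : R) := (rho0 x - J0 x) / 2 in
          forall t : R, 1 <= t ->
            (ess_sup_pm (fp t) (fm t) - ess_inf_pm (fp t) (fm t)
             <= (C d)%:E * (ess_sup_pm fp0 fm0 - ess_inf_pm fp0 fm0))%E].
Proof.
exists (1 / 4), (fun d => 1 - d + 4 * d ^+ 2); split.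
- by rewrite divr_gt0.
- by move=> d d0 d4; apply/andP; split; nra.
move=> d rho0 J0 rho J d0 rhoL JL mean weak fp fm fp0 fm0 t t1.
have aeF := ae_filter_ringOfSetsType (@lebesgue_measure R).
have [|m [M [SM Im bp bm]]] := @ess_pm_attained R fp0 fm0.
  have [B1 B10 h1] := Linfty_ae_bound rhoL; have [B2 B20 h2] := Linfty_ae_bound JL.
  exists (B1 + B2); apply: filterS2 h1 h2 => x /= h1 h2 Ix.
  have := h1 Ix; have := h2 Ix; rewrite !ler_norml => /andP[? ?] /andP[? ?].
  by rewrite /fp0 /fm0; split; apply/andP; split; lra.
have t0 : 0 <= t by rewrite (le_trans ler01).
have /andP[m0 M0] := bounds_sign weak rhoL mean bp bm.
suff [m1 [M1 [le1 H]]] : exists m1 M1 : R, M1 - m1 <= (1 - d + 4 * d ^+ 2) * (M - m) /\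
    forall th th', unit_test th th' ->
    m1 * mass th <= wave_pairing rho J th t <= M1 * mass th.
  have [S1 I1] := ess_pm_bounds (riemann_invariant_bounds weak t0 H).
  apply: (le_trans (leeB S1 I1)).
  by rewrite SM Im -!EFinB -EFinM lee_fin.
have dec := wave_pairing_decay weak d0 rhoL mean bp bm.
(* The factor exceeds [1] by [d * (4 * d - 1)], which changes sign at [1 / 4]. Up to that value
   [d <= 1] holds, as the contraction requires. *)
have [d4|d4] := leP d (1 / 4).
  exists ((1 - d) * m - 2 * d ^+ 2 * (M - m)), ((1 - d) * M + 2 * d ^+ 2 * (M - m)).
  split; first by rewrite le_eqVlt; apply/orP; left; apply/eqP; ring.
  move=> th th' UT; apply: (dec _ _ _ _ _ UT _ t1); right; split => //; lra.
exists m, M; split.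
  by rewrite ler_peMl ?subr_ge0 ?(le_trans m0)//; nra.
by move=> th th' UT; apply: (dec _ _ _ _ _ UT _ t1); left.
Qed.
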